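(* Let $\lambda\ge 0$ and let $Z$ be the complex-valued Ornstein-Uhlenbeck process with parameter $\lambda$ started from $z_0=1+i0$, with continuous winding process $\theta^{Z}$. Then the family of processes $$\left(t^{-1/2}\,\theta^{Z}_{st},\ s\ge 0\right)$$ converges in distribution, as $t\to 0$, to a one-dimensional Brownian motion $(\gamma_s,\ s\ge 0)$ started from $0$.
   Context: The complex-valued Ornstein-Uhlenbeck (OU) process $Z$ with parameter $\lambda\ge 0$ started from $z_0$ is the solution of $Z_t=z_0+W_t-\lambda\int_0^t Z_s\,ds$, where $(W_t,t\ge 0)$ is a planar (complex-valued) Brownian motion with $W_0=0$. Throughout, $z_0=1+i0$. The process $Z$ a.s. never visits $0$, and its continuous winding process around the origin is $\theta^Z_t=\mathrm{Im}\left(\int_0^t \frac{dZ_s}{Z_s}\right)$, $t\ge 0$, so $\theta^Z_0=0$. Convergence in distribution of processes is weak convergence in the sense of Skorokhod. *)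

(* Defs.v *)
From HB Require Import structures.
From mathcomp Require Import all_boot all_order all_algebra.
From mathcomp Require Import all_classical all_reals all_analysis.
From mathcomp Require Import complex.

Set Implicit Arguments.
Unset Strict Implicit.
Unset Printing Implicit Defensive.
Import Order.TTheory GRing.Theory Num.Theory.
Import numFieldNormedType.Exports.

Local Open Scope classical_set_scope.
Local Open Scope ring_scope.
Local Open Scope complex_scope.

(* Processes and paths are functions on the whole of R of which only the values
   at nonnegative times matter. *)

Section skorokhod.
Context {R : realType}.

Definition cadlag (x : R -> R) :=
  (forall s : R, 0 <= s -> x u @[u --> s^'+] --> x s) /\
  (forall s : R, 0 < s -> cvg (x u @[u --> s^'-])).

(* An increasing map of [0, +oo[ onto itself is automatically continuous. *)
Definition time_change (l : R -> R) :=
  {in `[0, +oo[ &, {homo l : s t / s < t}} /\ l @` `[0, +oo[ = `[0, +oo[%classic.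

(* Sequential characterization of the (metrizable) Skorokhod J1 topology on
   D([0, +oo[, R): Jacod-Shiryaev, Limit Theorems for Stochastic Processes,
   Theorem VI.1.14 *)
Definition skorokhod_cvg (x_ : nat -> R -> R) (x : R -> R) :=
  exists l : nat -> R -> R,
  [/\ forall n, time_change (l n),
      forall e : R, 0 < e -> \forall n \near \oo,
        forall s : R, 0 <= s -> `|l n s - s| <= e
    & forall N e : R, 0 < e -> \forall n \near \oo,
        forall s : R, 0 <= s <= N -> `|x_ n (l n s) - x s| <= e].

Definition skorokhod_continuous (f : (R -> R) -> R) :=
  forall (x_ : nat -> R -> R) (x : R -> R), (forall n, cadlag (x_ n)) ->
  cadlag x -> skorokhod_cvg x_ x -> f (x_ n) @[n --> \oo] --> f x.

Definition skorokhod_bounded (f : (R -> R) -> R) :=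
  exists M, forall x, cadlag x -> `|f x| <= M.

Definition cvg_in_law_skorokhod d (T : measurableType d) (P : probability T R)
    d' (T' : measurableType d') (Q : probability T' R)
    (I : Type) (X : I -> R -> T -> R) (F : set_system I) (Y : R -> T' -> R) :=
  forall f, skorokhod_continuous f -> skorokhod_bounded f ->
  ('E_P[fun w => f (X i ^~ w)] @[i --> F] --> 'E_Q[fun w => f (Y ^~ w)])%E.

End skorokhod.

Section brownian_motion.
Context {R : realType} d {T : measurableType d}.
Implicit Type P : probability T R.

(* sigma-algebra generated by the variables X s, s in J *)
Definition process_sigma d' (V : measurableType d') (X : R -> T -> V)
    (J : set R) : set_system T :=
  <<s \bigcup_(s in J) preimage_set_system [set: T] (X s) measurable >>.

Definition natural_filtration d' (V : measurableType d') (X : R -> T -> V)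
    (t : R) : set_system T := process_sigma X `[0, t].

Definition continuous_paths (X : R -> T -> R) :=
  forall w, {within `[0, +oo[, continuous (X ^~ w)}.

Definition increment (X : R -> T -> R) (s t : R) : T -> R :=
  fun w => X t w - X s w.

Record brownian_motion P (B : R -> T -> R) : Prop := {
  bm_measurable : forall t : R, 0 <= t -> measurable_fun [set: T] (B t) ;
  bm_continuous : continuous_paths B ;
  bm_start : forall w, B 0 w = 0 ;
  bm_normal : forall (s t : R) (A : set R), 0 <= s < t -> measurable A ->
    P (increment B s t @^-1` A) = normal_prob 0 (Num.sqrt (t - s)) A ;
  bm_indep : forall (s t : R) (E : set T) (A : set R), 0 <= s < t ->
    natural_filtration B s E -> measurable A ->
    P (E `&` increment B s t @^-1` A) = (P E * P (increment B s t @^-1` A))%E }.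

Definition independent_processes P (X Y : R -> T -> R) :=
  forall E F : set T, process_sigma X `[0, +oo[ E -> process_sigma Y `[0, +oo[ F ->
  (P (E `&` F) = P E * P F)%E.

Definition Re_process (Z : R -> T -> R[i]) : R -> T -> R :=
  fun t w => complex.Re (Z t w).
Definition Im_process (Z : R -> T -> R[i]) : R -> T -> R :=
  fun t w => complex.Im (Z t w).

Definition planar_brownian_motion P (W : R -> T -> R[i]) :=
  [/\ brownian_motion P (Re_process W), brownian_motion P (Im_process W)
    & independent_processes P (Re_process W) (Im_process W)].

End brownian_motion.

Section ornstein_uhlenbeck.
Context {R : realType} d {T : measurableType d}.
Implicit Type P : probability T R.

Definition path_integral (z : R -> R[i]) (t : R) : R[i] :=
  (\int[lebesgue_measure]_(s in `[0, t]) complex.Re (z s))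
  +i* (\int[lebesgue_measure]_(s in `[0, t]) complex.Im (z s)).

Record ou_process P (lambda : R) (z0 : R[i]) (W Z : R -> T -> R[i]) : Prop := {
  ou_measurable_Re :
    forall t : R, 0 <= t -> measurable_fun [set: T] (Re_process Z t) ;
  ou_measurable_Im :
    forall t : R, 0 <= t -> measurable_fun [set: T] (Im_process Z t) ;
  ou_continuous_Re : continuous_paths (Re_process Z) ;
  ou_continuous_Im : continuous_paths (Im_process Z) ;
  ou_equation : {ae P, forall w, forall t : R, 0 <= t ->
    Z t w = z0 + W t w - lambda%:C * path_integral (Z ^~ w) t} }.

End ornstein_uhlenbeck.

Section stochastic_integral.
Context {R : realType} d {T : measurableType d}.
Implicit Types (P : probability T R) (F : R -> set_system T).

(* R[i] carries no measurable structure in the library: identify it with R^2. *)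
Definition cpair (z : R[i]) : R * R := (complex.Re z, complex.Im z).

Definition cmeasurable_wrt (G : set_system T) (xi : T -> R[i]) :=
  forall A : set (R * R), measurable A -> G ((cpair \o xi) @^-1` A).

(* xi0 1_{0} + \sum_(i < n) xi_i 1_{]t_i, t_(i+1)]}, each xi_i being
   F_(t_i)-measurable *)
Record simple_process F := SimpleProcess {
  sp_size : nat ;
  sp_time : nat -> R ;
  sp_init : T -> R[i] ;
  sp_coef : nat -> T -> R[i] ;
  sp_time0 : sp_time 0 = 0 ;
  sp_time_nondecreasing :
    forall i, (i < sp_size)%N -> sp_time i <= sp_time i.+1 ;
  sp_init_adapted : cmeasurable_wrt (F 0) sp_init ;
  sp_coef_adapted :
    forall i, (i < sp_size)%N -> cmeasurable_wrt (F (sp_time i)) (sp_coef i) }.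

Definition sp_eval F (H : simple_process F) (s : R) (w : T) : R[i] :=
  (if s == 0 then sp_init H w else 0) +
  \sum_(i < sp_size H)
    (if sp_time H i < s <= sp_time H i.+1 then sp_coef H i w else 0).

Definition sp_integral F (H : simple_process F) (X : R -> T -> R[i])
    (s : R) (w : T) : R[i] :=
  \sum_(i < sp_size H) sp_coef H i w *
    (X (Num.min s (sp_time H i.+1)) w - X (Num.min s (sp_time H i)) w).

(* Uniform convergence on compacts in probability. The outer probability
   coincides with P on events; it spares measurability conditions on the
   suprema. *)
Definition ucp_cvg P (X_ : nat -> R -> T -> R[i]) (X : R -> T -> R[i]) :=
  forall S e : R, 0 < e ->
  mu_ext P [set w | exists2 s, 0 <= s <= S & e%:C < `|X_ n s w - X s w|]
    @[n --> \oo] --> 0%E.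

(* I = \int_0^. H_s dX_s, Itô integral as the ucp-continuous extension of the
   elementary integral of simple predictable processes (Protter, Stochastic
   Integration and Differential Equations, Section II.4) *)
Definition is_stochastic_integral P F (H X I : R -> T -> R[i]) :=
  exists2 H_ : nat -> simple_process F,
    ucp_cvg P (fun n => sp_eval (H_ n)) H &
    ucp_cvg P (fun n => sp_integral (H_ n) X) I.

Record winding_process P F (Z : R -> T -> R[i]) (theta : R -> T -> R) : Prop := {
  winding_measurable : forall t : R, 0 <= t -> measurable_fun [set: T] (theta t) ;
  winding_continuous : continuous_paths theta ;
  winding_integral :
    exists2 I, is_stochastic_integral P F (fun s w => (Z s w)^-1) Z I &
    {ae P, forall w, forall t : R, 0 <= t -> theta t w = complex.Im (I t w)} }.

End stochastic_integral.

(* Main.v *)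
From HB Require Import structures.
Require Import Defs.
From mathcomp Require Import all_boot all_order all_algebra.
From mathcomp Require Import all_classical all_reals all_analysis.
From mathcomp Require Import measurable_realfun complex.
From mathcomp Require Import ring lra.
Import Order.TTheory GRing.Theory Num.Theory.
Import numFieldNormedType.Exports.
Local Open Scope classical_set_scope.
Local Open Scope ring_scope.
Local Open Scope complex_scope.

(** The winding is the imaginary part of the integral of [dZ / Z]. Near time 0
the process [Z] is close to its starting point 1 and its drift is of order [t],
so that the winding at time [t] is [Im W t] up to an error that is negligible
against [sqrt t]; and [t ^ (- 1/2) Im W (s t)] is a Brownian motion in [s] for
every [t > 0], by scaling.

The comparison is [winding_close]: up to a small probability, the winding and
[Im W] stay within [e * sqrt tau] of each other on [[0, tau]]. The stochastic
integral is only known as a limit, uniformly on compacts in probability, of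
elementary integrals of simple processes close to [1 / Z], hence to 1. By
[csimple_integral_sub_bound], such an elementary integral differs from [Im W] by
a Lipschitz drift and by elementary integrals of real Brownian motions with small
coefficients, once these coefficients are cut off. The latter are controlled
uniformly in time by the maximal inequality [simple_integral_maximal], which
comes from the discrete inequality [transform_maximal] on finer and finer grids.
It needs the real and imaginary parts of [W] to be Brownian motions for the
filtration of the pair, which is [planar_brownian_motion_wrt].

To pass to convergence in law, a bounded functional [f] that is continuous for
the Skorokhod topology is continuous for the locally uniform convergence of
continuous paths. Its expectation along a continuous process only depends on the
joint law of the increments on regular meshes ([same_boxes_integral]); the latter
is the same for all Brownian motions, rescaled ones included ([brownian_boxP],
[rescaled_box]). Let [X] be the rescaled winding and [Y] the rescaled [Im W].
Their values under [f] are not compared through a uniform continuity of [f],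
which may fail, but through the oscillation [modulus f dl Y] of [f] near the path
[Y]. The expectation of this oscillation does not depend on [t], and tends to 0
with [dl] by dominated convergence ([modulus_integral_cvg0]). So
[functional_distance] bounds the difference of the expectations of [f X] and
[f Y] by this expectation, plus a multiple of the probability that [X] and [Y]
are apart. *)

Set Implicit Arguments.
Unset Strict Implicit.
Unset Printing Implicit Defensive.

(** * Gaussian laws *)

(** The canonical measure structure of [pushforward] with the measurability
proof made explicit, so that an image measure can be named. *)
Definition image_measure (R : realType) d1 d2 (T1 : measurableType d1)
    (T2 : measurableType d2) (m : {measure set T1 -> \bar R}) (f : T1 -> T2)
    (mf : measurable_fun [set: T1] f) : {measure set T2 -> \bar R} :=
  ltac:(refine (pushforward m f : {measure set T2 -> \bar R}); exact: mf).

Section gaussian.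
Context {R : realType}.
Local Notation mu := (@lebesgue_measure R).

(** Both sides are measures in [A] that agree on half-open intervals. *)
Lemma lebesgue_measure_scale (c : R) (A : set R) : c != 0 -> measurable A ->
  mu A = (`|c|%:E * mu ((fun x : R => c * x)%R @^-1` A))%E.
Proof.
move=> c0.
have mc : measurable_fun [set: R] (fun x : R => c * x) by exact: measurable_funM.
have nc : 0 <= `|c| by [].
have mcL : @measurable_fun _ _ (measurableTypeR R) (measurableTypeR R) setT
  (fun x : R => c * x) by exact: mc.
pose nu : {measure set (measurableTypeR R) -> \bar R} :=
  mscale (NngNum nc) (image_measure mu mcL).
rewrite (_ : (`|c|%:E * _)%E = nu A)//.
apply: (@lebesgue_measure_unique _ nu) => // _ [[a b] _ <-].
transitivity (`|c|%:E * mu ((fun x : R => (c * x)%R) @^-1` `]a, b]))%E; last by [].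
have -> : (fun x : R => c * x) @^-1` `]a, b] =
  [set` if 0 < c then `](a / c), (b / c)] else `[(b / c), (a / c)[].
  have [c1|c1|c1] := ltgtP 0 c; last by rewrite -c1 eqxx in c0.
    apply/seteqP; split => x /=; rewrite !in_itv/= ltr_pdivrMr// ler_pdivlMr//;
    by rewrite !(mulrC c).
  apply/seteqP; split => x /=; rewrite !in_itv/= ler_ndivrMr// ltr_ndivlMr//;
  by rewrite !(mulrC c) andbC.
have [c1|c1|c1] := ltgtP 0 c; last by rewrite -c1 eqxx in c0.
  rewrite !lebesgue_measure_itv/= !lte_fin ltr_pM2r ?invr_gt0//.
  case: ifPn => ab; last by rewrite mule0.
  by rewrite -EFinD -EFinM gtr0_norm// -mulrBl mulrC divfK// EFinB.
rewrite !lebesgue_measure_itv/= !lte_fin ltr_nM2r ?invr_lt0//.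
case: ifPn => ab; last by rewrite mule0.
by rewrite -EFinD -EFinM ltr0_norm// -mulrBl mulrC mulrN divfK// opprB EFinB.
Qed.

Lemma normal_pdf_scale (c s x : R) : c != 0 -> s != 0 ->
  `|c| * normal_pdf 0 (c * s) (c * x) = normal_pdf 0 s x.
Proof.
move=> c0 s0; rewrite !normal_pdfE ?mulf_neq0// /normal_peak /normal_fun !subr0.
rewrite mulrA; congr (_ * expR _); last first.
  by field; rewrite c0 s0.
rewrite exprMn -mulrA -mulrnAr sqrtrM ?sqr_ge0// sqrtr_sqr invfM mulrA.
by rewrite divff ?normr_eq0// mul1r.
Qed.

(** A change of variables: the Jacobian [`|c|] is the ratio of the two
densities. *)
Lemma normal_prob_scale (c s : R) (A : set R) : c != 0 -> s != 0 ->
  measurable A ->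
  normal_prob 0 s ((fun x => c * x) @^-1` A) = normal_prob 0 (c * s) A.
Proof.
move=> c0 s0 mA.
have mc : measurable_fun [set: R] (fun x : R => c * x) by exact: measurable_funM.
have nc : 0 <= `|c| by [].
have mcL : @measurable_fun _ _ (measurableTypeR R) (measurableTypeR R) setT
  (fun x : R => c * x) by exact: mc.
have mN s' : measurable_fun A (EFin \o normal_pdf 0 s').
  by apply/measurable_EFinP/measurable_funTS; exact: measurable_normal_pdf.
rewrite /normal_prob.
rewrite [RHS](@eq_measure_integral _ _ _ _ (mscale (NngNum nc) (image_measure mu mcL))).
  rewrite ge0_integral_mscale//=; last 2 first.
  - exact: mN.
  - by move=> x _; rewrite lee_fin normal_pdf_ge0.
  rewrite ge0_integral_pushforward//; last 2 first.
  - exact: mN.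
  - by move=> x _; rewrite lee_fin normal_pdf_ge0.
  rewrite -ge0_integralZl//=.
  - by apply: eq_integral => x _; rewrite -EFinM normal_pdf_scale.
  - by rewrite -[X in measurable X]setTI; exact: mc.
  - apply/measurable_EFinP; apply: measurable_funTS.
    by apply: measurableT_comp => //; exact: measurable_normal_pdf.
  - by move=> x _; rewrite lee_fin normal_pdf_ge0.
by move=> B mB _; exact: lebesgue_measure_scale.
Qed.

(** The density [normal_pdf] is almost everywhere the Radon-Nikodym derivative,
for which the change of variables holds. *)
Lemma ge0_integral_normal_prob (s : R) (f : R -> \bar R) : s != 0 ->
  measurable_fun [set: R] f -> (forall x, 0 <= f x)%E ->
  (\int[normal_prob 0 s]_x f x = \int[mu]_x (f x * (normal_pdf 0 s x)%:E))%E.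
Proof.
move=> s0 mf f0.
have dom := normal_prob_dominates 0 s.
rewrite -(Radon_Nikodym_SigmaFinite.change_of_variables dom)//.
apply: ae_eq_integral => //.
- apply: emeasurable_funM => //.
  exact: measurable_int (Radon_Nikodym_SigmaFinite.f_integrable dom).
- apply: emeasurable_funM => //; apply/measurable_EFinP.
  exact: measurable_normal_pdf.
apply: ae_eqe_mul2l; apply: integral_ae_eq => //.
- exact: Radon_Nikodym_SigmaFinite.f_integrable.
- by apply/measurable_EFinP; exact: measurable_normal_pdf.
- by move=> A _ mA; rewrite -Radon_Nikodym_SigmaFinite.f_integral.
Qed.

(** The bound [x ^ 2 * exp (- x ^ 2 / (4 s ^ 2)) <= 4 s ^ 2] trades the second
moment for the total mass of a wider Gaussian; only its order in [s] matters. *)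
Lemma normal_prob_moment2 (s : R) : s != 0 ->
  (\int[normal_prob 0 s]_x (x ^+ 2)%:E <= (8 * s ^+ 2)%:E)%E.
Proof.
move=> s0; rewrite ge0_integral_normal_prob//; last 2 first.
- by apply/measurable_EFinP; exact: measurable_funX.
- by move=> x; rewrite lee_fin sqr_ge0.
have h2 : 0 < Num.sqrt 2 :> R by rewrite sqrtr_gt0.
have h20 : Num.sqrt 2 != 0 :> R by rewrite gt_eqF.
have sq2 : Num.sqrt 2 ^+ 2 = 2 :> R by rewrite sqr_sqrtr.
have h22 : Num.sqrt 2 <= 2 :> R by nra.
have s2 : 0 < s ^+ 2 by rewrite exprn_even_gt0.
apply: (@le_trans _ _ (\int[mu]_x ((8 * s ^+ 2)%:E *
    (normal_pdf 0 (Num.sqrt 2 * s) x)%:E)))%E.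
  apply: ge0_le_integral => //=.
  - by move=> x _; rewrite -EFinM lee_fin mulr_ge0 ?sqr_ge0 ?normal_pdf_ge0.
  - apply/measurable_EFinP; apply: measurable_funM; first exact: measurable_funX.
    exact: measurable_normal_pdf.
  - apply/measurable_EFinP; apply: measurable_funM => //.
    exact: measurable_normal_pdf.
  - move=> x _; rewrite -!EFinM lee_fin.
    rewrite !normal_pdfE ?mulf_neq0//.
    have pk : normal_peak s = Num.sqrt 2 * normal_peak (Num.sqrt 2 * s).
      rewrite /normal_peak (_ : (_ * s) ^+ 2 * pi *+ 2 = 2 * (s ^+ 2 * pi *+ 2)).
        by rewrite [in RHS]sqrtrM// invfM mulrA divff// mul1r.
      by rewrite exprMn sq2; ring.
    rewrite pk /normal_fun !subr0 exprMn sq2.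
    have p0 : 0 <= normal_peak (Num.sqrt 2 * s) by exact: normal_peak_ge0.
    set u := x ^+ 2 / (4 * s ^+ 2).
    have -> : - x ^+ 2 / (s ^+ 2 *+ 2) = - u - u by rewrite /u; field.
    have -> : - x ^+ 2 / ((2 * s ^+ 2) *+ 2) = - u by rewrite /u; field.
    have -> : x ^+ 2 = 4 * s ^+ 2 * u by rewrite /u; field.
    rewrite expRD.
    have ue : u * expR (- u) <= 1.
      by rewrite expRN ler_pdivrMr ?expR_gt0// mul1r; apply: le_trans (expR_ge1Dx u); lra.
    have e0 : 0 < expR (- u) by exact: expR_gt0.
    apply: (@le_trans _ _ (4 * s ^+ 2 * (Num.sqrt 2 *
      (normal_peak (Num.sqrt 2 * s) * expR (- u))) * (u * expR (- u)))).
      by rewrite le_eqVlt; apply/orP; left; apply/eqP; ring.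
    apply: (@le_trans _ _ (4 * s ^+ 2 * (Num.sqrt 2 *
      (normal_peak (Num.sqrt 2 * s) * expR (- u))) * 1)).
      apply: ler_wpM2l => //; apply: mulr_ge0; first by rewrite mulr_ge0 ?(ltW s2).
      by apply: mulr_ge0; [exact: ltW|apply: mulr_ge0; [|exact: ltW]].
    rewrite mulr1 mulrA; apply: ler_wpM2r; first by rewrite mulr_ge0 ?(ltW e0).
    have -> : 8 * s ^+ 2 = 4 * s ^+ 2 * 2 by ring.
    by apply: ler_wpM2l => //; rewrite mulr_ge0 ?(ltW s2).
rewrite ge0_integralZl//=.
- by rewrite integral_normal_pdf mule1.
- by apply/measurable_EFinP; exact: measurable_normal_pdf.
- by move=> x _; rewrite lee_fin normal_pdf_ge0.
- by rewrite lee_fin mulr_ge0// ltW.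
Qed.

Lemma integrable_normal_prob_id (s : R) : s != 0 ->
  (normal_prob 0 s).-integrable [set: R] EFin.
Proof.
move=> s0; apply/integrableP; split => //.
have hint : (\int[normal_prob 0 s]_x (1 + x ^+ 2)%:E <= (1 + 8 * s ^+ 2)%:E)%E.
  under eq_integral do rewrite EFinD.
  rewrite ge0_integralD//=; last 2 first.
  - by move=> x _; rewrite lee_fin sqr_ge0.
  - by apply/measurable_EFinP; exact: measurable_funX.
  have N1 : normal_prob 0 s [set: R] = 1%E.
    by rewrite /normal_prob integral_normal_pdf.
  rewrite integral_cst//= N1 mule1 EFinD leeD2l//.
  exact: normal_prob_moment2.
apply: le_lt_trans (le_lt_trans hint (ltry _)).
apply: ge0_le_integral => //=.
- exact: measurableT_comp.
- by apply/measurable_EFinP/measurable_funD => //; exact: measurable_funX.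
- move=> x _; rewrite lee_fin.
  have := sqr_ge0 (`|x| - 1); rewrite -(real_normK (num_real x)).
  have := normr_ge0 x; nra.
Qed.

(** The law is invariant under [x |-> - x], so that its mean is its own
opposite. *)
Lemma normal_prob_mean (s : R) : s != 0 ->
  (\int[normal_prob 0 s]_x x%:E = 0)%E.
Proof.
move=> s0.
have mN : @measurable_fun _ _ (measurableTypeR R) (measurableTypeR R) setT
  (fun x : R => -1 * x) by exact: measurable_funM.
have iN := integrable_normal_prob_id s0.
have E : (\int[normal_prob 0 s]_x x%:E = - \int[normal_prob 0 s]_x x%:E)%E.
  rewrite [LHS](@eq_measure_integral _ _ _ _ (image_measure (normal_prob 0 s) mN)).
    rewrite integral_pushforward//=.
      rewrite -integralN//=; last exact: integrable_add_def.
      by apply: eq_integral => x _; rewrite mulN1r.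
    rewrite preimage_setT (_ : _ \o _ = (\- EFin)%E); first exact: integrableN.
    by apply/funext => x; rewrite /= mulN1r.
  move=> A mA _; transitivity (normal_prob 0 (-1 * s) A); last first.
    have m1 : -1 != 0 :> R by rewrite oppr_eq0 oner_eq0.
    exact: (esym (normal_prob_scale m1 s0 mA)).
  rewrite /normal_prob; apply: eq_integral => x _; congr EFin.
  rewrite !normal_pdfE// ?mulf_neq0// ?oppr_eq0 ?oner_eq0//.
  by rewrite /normal_peak /normal_fun !exprMn sqrrN expr1n mul1r.
have fin : (\int[normal_prob 0 s]_x x%:E)%E \is a fin_num.
  exact: integrable_fin_num.
move: E; rewrite -(fineK fin) -EFinN => -[] h; congr EFin; lra.
Qed.

End gaussian.

(** * Martingale transforms and Kolmogorov's maximal inequality *)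

Section independence.
Context {R : realType} d {T : measurableType d} (P : probability T R).
Local Open Scope ereal_scope.

(** Independence makes the joint law a product measure; Fubini's theorem then
factors the integral. *)
Lemma integrable_mul_indep (X Y : {RV P >-> R}) :
  (forall A B : set R, measurable A -> measurable B ->
    P (Y @^-1` A `&` X @^-1` B) = P (Y @^-1` A) * P (X @^-1` B)) ->
  P.-integrable setT (EFin \o X) -> P.-integrable setT (EFin \o Y) ->
  \int[P]_w (X w)%:E = 0 ->
  P.-integrable setT (fun w => (Y w * X w)%:E) /\
  \int[P]_w (Y w * X w)%:E = 0.
Proof.
move=> ind iX iY X0.
have mYX : measurable_fun [set: T] (fun w => (Y w, X w)).
  exact: measurable_fun_pair.
pose f := fun z : R * R => (z.1 * z.2)%:E.
have mf : measurable_fun [set: R * R] f.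
  apply/measurable_EFinP; apply: measurable_realfun.measurable_funM.
    exact: measurable_fst.
  exact: measurable_snd.
pose D := distribution P Y \x distribution P X.
have joint (A : set (R * R)) : measurable A -> D A = image_measure P mYX A.
  by move=> mA; rewrite /D; exact: product_measure_unique.
have jointE (g : R * R -> \bar R) :
    \int[D]_z g z = \int[image_measure P mYX]_z g z.
  by apply: eq_measure_integral => A mA _; exact: joint.
have fin (Z : {RV P >-> R}) : P.-integrable setT (EFin \o Z) ->
    \int[distribution P Z]_x `|x%:E| < +oo.
  move=> /integrableP[_]; rewrite ge0_integral_distribution//.
  exact: measurableT_comp.
have iD : D.-integrable setT f.
  apply/integrable12ltyP => //.
  rewrite (_ : (\int[_]_x _) = \int[distribution P Y]_x (`|x%:E| *
      \int[distribution P X]_y `|y%:E|)).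
    rewrite ge0_integralZr//; last first.
    - by apply: integral_ge0.
    - exact: measurableT_comp.
    by apply: lte_mul_pinfty; [exact: integral_ge0| |exact: fin];
      rewrite ge0_fin_numE ?integral_ge0// fin.
  apply: eq_integral => x _; rewrite -ge0_integralZl//.
  - by apply: eq_integral => y _; rewrite /f /= normrM.
  - exact: measurableT_comp.
have iP : (image_measure P mYX).-integrable setT f.
  apply/integrableP; split => //.
  by move/integrableP : iD => [_]; rewrite jointE.
have iYX : P.-integrable setT (fun w => (Y w * X w)%:E).
  apply/integrableP; split.
    by apply/measurable_EFinP; exact: measurable_realfun.measurable_funM.
  move/integrableP : iP => [_]; rewrite ge0_integral_pushforward//.
  exact: measurableT_comp.
split=> //; transitivity (\int[image_measure P mYX]_z f z).
  by rewrite integral_pushforward// preimage_setT.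
rewrite -jointE -integral12_prod_meas1// integral0_eq// => x _.
rewrite /fubini_F /f /=.
under eq_integral do rewrite EFinM.
rewrite integralZl//=.
  by rewrite integral_distribution//= X0 mule0.
apply/integrableP; split => //; exact: fin.
Qed.

End independence.

Section martingale_transform.
Context {R : realType} d {T : measurableType d} (P : probability T R).

(** [T] seen through the sigma-algebra generated by [G], so that the
measurability lemmas apply to real functions measurable for that sigma-algebra. *)
Definition meas_wrt (G : set_system T) (f : T -> R) :=
  measurable_fun [set: g_sigma_algebraType G] (f : g_sigma_algebraType G -> R).

Lemma meas_wrtP (G : set_system T) (f : T -> R) :
  meas_wrt G f <-> forall A, measurable A -> <<s G >> (f @^-1` A).
Proof.
split=> [mf A mA|h _ A mA].
  by have := mf measurableT A mA; rewrite setTI.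
by rewrite setTI; exact: h.
Qed.

Lemma meas_wrt_sub (G H : set_system T) (f : T -> R) :
  <<s G >> `<=` <<s H >> -> meas_wrt G f -> meas_wrt H f.
Proof. by move=> GH /meas_wrtP mf; apply/meas_wrtP => A mA; apply: GH; exact: mf. Qed.

Lemma meas_wrt_measurable (G : set_system T) (f : T -> R) :
  <<s G >> `<=` measurable -> meas_wrt G f -> measurable_fun [set: T] f.
Proof. by move=> GT /meas_wrtP mf _ A mA; rewrite setTI; apply: GT; exact: mf. Qed.

Definition indep_of (G : set_system T) (X : T -> R) :=
  forall (E : set T) (A : set R), <<s G >> E -> measurable A ->
  (P (E `&` X @^-1` A) = P E * P (X @^-1` A))%E.

(** The centered square-integrable noise [X j] is revealed at step [j.+1] and is
independent of what is known at step [j]. *)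
Record noise (n : nat) (G : nat -> set_system T) (X : nat -> T -> R)
    (v : nat -> R) : Prop := {
  noise_sub : forall j, (j <= n)%N -> <<s G j >> `<=` measurable ;
  noise_incr : forall j, (j < n)%N -> <<s G j >> `<=` <<s G j.+1 >> ;
  noise_adapted : forall j, (j < n)%N -> meas_wrt (G j.+1) (X j) ;
  noise_indep : forall j, (j < n)%N -> indep_of (G j) (X j) ;
  noise_integrable : forall j, (j < n)%N -> P.-integrable setT (EFin \o X j) ;
  noise_mean : forall j, (j < n)%N -> (\int[P]_w (X j w)%:E = 0)%E ;
  noise_moment2 : forall j, (j < n)%N ->
    (\int[P]_w (X j w ^+ 2)%:E <= (v j)%:E)%E }.

Definition transform (k X : nat -> T -> R) (n : nat) (w : T) : R :=
  \sum_(j < n) k j w * X j w.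

Lemma transformS k X n w :
  transform k X n.+1 w = transform k X n w + k n w * X n w.
Proof. by rewrite /transform big_ord_recr. Qed.

Section transform.
Context (n : nat) (G : nat -> set_system T) (k X : nat -> T -> R)
  (v : nat -> R) (c : R).
Hypothesis nX : noise n G X v.
Hypothesis mk : forall j, (j < n)%N -> meas_wrt (G j) (k j).
Hypothesis kc : forall j w, (j < n)%N -> `|k j w| <= c.

Lemma transform_adapted m : (m <= n)%N -> meas_wrt (G m) (transform k X m).
Proof.
elim: m => [_|m IH mn].
  rewrite (_ : transform k X 0 = cst 0); first exact: measurable_cst.
  by apply/funext => w; rewrite /transform big_ord0.
rewrite (_ : transform k X m.+1 = fun w => transform k X m w + k m w * X m w).
  have sub := noise_incr nX mn.
  apply: measurable_funD; first exact: (meas_wrt_sub sub (IH (ltnW mn))).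
  apply: measurable_realfun.measurable_funM.
    exact: (meas_wrt_sub sub (mk mn)).
  exact: (noise_adapted nX mn).
by apply/funext => w; rewrite transformS.
Qed.

Lemma transform_measurable m : (m <= n)%N -> measurable_fun setT (transform k X m).
Proof.
by move=> mn; apply: (meas_wrt_measurable (noise_sub nX mn)); exact: transform_adapted.
Qed.

(** In the square of [S + k X] the cross term [2 S k X] has mean 0, because [S
k] is known before [X] is revealed, and the last term is at most [c ^ 2 X ^ 2].
*)
Lemma transform_moment2 m : (m <= n)%N ->
  (\int[P]_w (transform k X m w ^+ 2)%:E <= (c ^+ 2 * \sum_(j < m) v j)%:E)%E.
Proof.
elim: m => [_|m IH mn].
  rewrite big_ord0 mulr0 integral0_eq// => w _.
  by rewrite /transform big_ord0 expr0n.
have mn' := ltnW mn.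
have c0 : 0 <= c.
  have [w _] : [set: T] !=set0.
    apply/set0P/eqP => T0; have := @probability_setT _ _ _ P.
    by rewrite T0 measure0 => /eqP; rewrite eq_sym onee_eq0.
  by apply: le_trans (kc w mn).
have mS := transform_measurable mn'.
have mkT : measurable_fun setT (k m).
  exact: (meas_wrt_measurable (noise_sub nX mn') (mk mn)).
have mX : measurable_fun setT (X m).
  exact: (meas_wrt_measurable (noise_sub nX mn) (noise_adapted nX mn)).
have iX := noise_integrable nX mn.
have mS2 : measurable_fun setT (fun w => (transform k X m w ^+ 2)%:E).
  by apply/measurable_EFinP; exact: measurable_realfun.measurable_funX.
have iS2 : P.-integrable setT (fun w => (transform k X m w ^+ 2)%:E).
  apply/integrableP; split => //.
  apply: le_lt_trans (le_lt_trans (IH mn') (ltry _)).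
  rewrite le_eqVlt; apply/orP; left; apply/eqP; apply: eq_integral => w _.
  by rewrite /= ger0_norm// sqr_ge0.
have i1 : P.-integrable setT (fun=> 1%E : \bar R).
  by apply: finite_measure_integrable_cst.
have mkS : measurable_fun setT (fun w => transform k X m w * k m w).
  exact: measurable_realfun.measurable_funM.
have ikS : P.-integrable setT (EFin \o (fun w => transform k X m w * k m w)).
  apply: (@le_integrable _ _ _ P setT measurableT _
    (fun w => c%:E * (1 + (transform k X m w ^+ 2)%:E))%E) => //.
  - exact/measurable_EFinP.
  - move=> w _; rewrite /= lee_fin normrM [leRHS]ger0_norm; last first.
      by rewrite mulr_ge0// addr_ge0// sqr_ge0.
    rewrite mulrC; apply: ler_pM => //; first exact: kc.
    have := sqr_ge0 (`|transform k X m w| - 1).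
    rewrite -(real_normK (num_real (transform k X m w))).
    have := normr_ge0 (transform k X m w); nra.
  - by apply: integrableZl => //; exact: integrableD.
pose X' : {mfun T >-> R} := mfun_Sub (mem_set mX).
pose Y' : {mfun T >-> R} := mfun_Sub (mem_set mkS).
have [iYX YX0] : P.-integrable setT (fun w => (Y' w * X' w)%:E) /\
  (\int[P]_w (Y' w * X' w)%:E = 0)%E.
  apply: integrable_mul_indep => //; last exact: (noise_mean nX mn).
  move=> A B mA mB; apply: (noise_indep nX mn) => //.
  have /meas_wrtP : meas_wrt (G m) Y'; last exact.
  by apply: measurable_realfun.measurable_funM; [exact: transform_adapted|exact: mk].
have mX2 : measurable_fun setT (fun w => (X m w ^+ 2)%:E).
  by apply/measurable_EFinP; exact: measurable_realfun.measurable_funX.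
have iX2 : P.-integrable setT (fun w => (X m w ^+ 2)%:E).
  apply/integrableP; split => //.
  apply: le_lt_trans (le_lt_trans (noise_moment2 nX mn) (ltry _)).
  rewrite le_eqVlt; apply/orP; left; apply/eqP; apply: eq_integral => w _.
  by rewrite /= ger0_norm// sqr_ge0.
apply: (@le_trans _ _ (\int[P]_w ((transform k X m w ^+ 2)%:E +
    (2%:E * (Y' w * X' w)%:E + (c ^+ 2)%:E * (X m w ^+ 2)%:E)))%E).
  apply: le_integral => //.
  - apply: (@le_integrable _ _ _ P setT measurableT _ (fun w => 2%:E *
      ((transform k X m w ^+ 2)%:E + (c ^+ 2)%:E * (X m w ^+ 2)%:E))%E).
    + apply/measurable_EFinP; apply: measurable_realfun.measurable_funX.
      exact: transform_measurable.
    + move=> w _; rewrite /= lee_fin.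
      rewrite (ger0_norm (sqr_ge0 _)) [leRHS]ger0_norm; last first.
        apply: mulr_ge0 => //; apply: addr_ge0; first exact: sqr_ge0.
        by apply: mulr_ge0; exact: sqr_ge0.
      rewrite transformS.
      have h : (k m w * X m w) ^+ 2 <= c ^+ 2 * X m w ^+ 2.
        rewrite exprMn ler_wpM2r ?sqr_ge0// -(real_normK (num_real (k m w))).
        by rewrite lerXn2r ?nnegrE ?kc.
      have := sqr_ge0 (transform k X m w - k m w * X m w); lra.
    + by apply: integrableZl => //; apply: integrableD => //; exact: integrableZl.
  - by apply: integrableD => //; apply: integrableD => //; exact: integrableZl.
  - move=> w _; rewrite -!EFinM -!EFinD lee_fin transformS /=.
    have h : (k m w * X m w) ^+ 2 <= c ^+ 2 * X m w ^+ 2.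
      rewrite exprMn ler_wpM2r ?sqr_ge0// -(real_normK (num_real (k m w))).
      by rewrite lerXn2r ?nnegrE ?kc.
    by rewrite sqrrD; lra.
rewrite integralD//=; last first.
  by apply: integrableD => //; exact: integrableZl.
rewrite integralD//=; [|exact: integrableZl|exact: integrableZl].
rewrite !integralZl//= YX0 mule0 add0e big_ord_recr/= mulrDr EFinD.
apply: leeD; first exact: IH.
rewrite [leRHS]EFinM; apply: lee_wpmul2l; first by rewrite lee_fin sqr_ge0.
exact: (noise_moment2 nX mn).
Qed.

End transform.

(** Being a product of indicators, it is adapted for the same reason as any
product of adapted variables, with no recourse to stopping times. *)
Definition survival (a : R) (S : nat -> T -> R) (j : nat) (w : T) : R :=
  \prod_(i < j.+1) \1_(`[- a, a]) (S i w).

Lemma survival1 a S j w : (forall i, (i <= j)%N -> `|S i w| <= a) ->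
  survival a S j w = 1.
Proof.
move=> h; rewrite /survival big1// => -[i ij] _ /=.
by rewrite indicE mem_set//= in_itv/= -ler_norml h.
Qed.

Lemma survival0 a S j w i : (i <= j)%N -> a < `|S i w| -> survival a S j w = 0.
Proof.
move=> ij h; rewrite /survival (bigD1 (Ordinal (ij : (i < j.+1)%N)))//=.
by rewrite indicE memNset ?mul0r//= in_itv/= -ler_norml; apply/negP; rewrite -ltNge.
Qed.

Lemma survival_le1 a S j w : 0 <= survival a S j w <= 1.
Proof.
apply/andP; split; first by apply: prodr_ge0 => i _; rewrite indicE.
by apply: prodr_ile1 => i _; rewrite indicE; case: (_ \in _); rewrite ?lexx ?ler01.
Qed.

(** Stopping the transform when it first leaves [[- a, a]] only multiplies the
coefficients by predictable indicators, so the second moment bound survives, and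
the stopped transform is still outside [[- a, a]] at the end: Markov's
inequality then concludes. *)
Lemma transform_maximal n G k X v (c a : R) : noise n G X v ->
  (forall j, (j < n)%N -> meas_wrt (G j) (k j)) ->
  (forall j w, (j < n)%N -> `|k j w| <= c) -> 0 < a ->
  exists D : set T, [/\ measurable D,
    (P D <= (c ^+ 2 * (\sum_(j < n) v j) / a ^+ 2)%:E)%E &
    forall w m, (m <= n)%N -> a < `|transform k X m w| -> D w].
Proof.
move=> nX mk kc a0.
pose S := transform k X.
pose k' j w := survival a S j w * k j w.
have mk' j : (j < n)%N -> meas_wrt (G j) (k' j).
  move=> jn; apply: measurable_realfun.measurable_funM; last exact: mk.
  apply: measurable_prod => i _.
  apply: (measurableT_comp (measurable_indic _)); first exact: measurable_itv.
  have ij : (i <= j)%N by rewrite -ltnS.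
  have: meas_wrt (G i) (S i).
    by apply: (transform_adapted nX mk); rewrite (leq_trans ij)// ltnW.
  apply: meas_wrt_sub.
  have : (j <= n)%N by exact: ltnW.
  move: (nat_of_ord i) ij => {}i; clear -nX; elim: j => [|j IH].
    by rewrite leqn0 => /eqP -> _; exact: subset_refl.
  rewrite leq_eqVlt => /orP[/eqP -> _|ij jn]; first exact: subset_refl.
  by apply: subset_trans (noise_incr nX jn); apply: IH => //; exact: ltnW.
have kc' j w : (j < n)%N -> `|k' j w| <= c.
  move=> jn; rewrite normrM; have /andP[s0 s1] := survival_le1 a S j w.
  rewrite ger0_norm//; apply: le_trans (kc j w jn).
  by rewrite ler_piMl.
have mS' := transform_measurable nX mk' (leqnn n).
pose S' : {mfun T >-> R} := mfun_Sub (mem_set mS').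
exists [set w | (a%:E <= `|(S' w)%:E|)%E]; split.
- rewrite (_ : [set _ | _] = ((fun x : R => `|x|) \o S') @^-1` `[a, +oo[).
    by rewrite -[X in measurable X]setTI; apply: measurableT_comp => //; exact: measurable_itv.
  by apply/seteqP; split => w /=; rewrite in_itv/= andbT lee_fin.
- rewrite EFinM lee_pdivlMr ?exprn_gt0// muleC.
  apply: le_trans (transform_moment2 nX mk' kc' (leqnn n)).
  apply: (le_trans (@markov _ _ _ P S' (fun r => r ^+ 2) a a0 _ _ _)).
  + exact: measurable_realfun.measurable_funX.
  + by move=> r r0; exact: sqr_ge0.
  + by move=> x y; rewrite !nnegrE => x0 y0 xy; rewrite lerXn2r ?nnegrE.
  + rewrite unlock le_eqVlt; apply/orP; left; apply/eqP.
    by apply: eq_integral => w _ /=; rewrite real_normK ?num_real.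
- move=> w m mn am /=.
  have exm : exists m, (m <= n)%N && (a < `|S m w|) by exists m; rewrite mn.
  case: (ex_minnP exm) => m0 /andP[m0n am0] min.
  have E1 : transform k' X m0 w = S m0 w.
    apply: eq_bigr => -[j jm0] _ /=; rewrite /k' survival1 ?mul1r// => i ij.
    rewrite leNgt; apply/negP => ai.
    have := min i; rewrite ai (leq_trans _ m0n)/=; last by apply: (leq_trans ij); exact: ltnW.
    by move=> /(_ isT); rewrite leqNgt (leq_ltn_trans ij jm0).
  have E2 l : transform k' X (m0 + l) w = S m0 w.
    elim: l => [|l IH]; first by rewrite addn0.
    rewrite addnS transformS IH /k' (survival0 (leq_addr _ _) am0).
    by rewrite !mul0r addr0.
  by have := E2 (n - m0)%N; rewrite subnKC// => ->; rewrite lee_fin ltW.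
Qed.

End martingale_transform.

(** * Stochastic integrals of simple processes against Brownian motion *)

Section paths.
Context {R : realType}.

Lemma continuous_path_at (x : R -> R) : {within `[0, +oo[, continuous x} ->
  forall s e : R, 0 <= s -> 0 < e -> exists2 dl : R, 0 < dl &
    forall u, 0 <= u -> `|u - s| < dl -> `|x u - x s| < e.
Proof.
move=> /subspace_continuousP cx s e s0 e0.
have As : `[0, +oo[%classic s by rewrite /= in_itv/= s0.
have /cvgrPdist_lt/(_ e e0) := cx s As.
rewrite near_withinE => /nbhs_ballP[dl /= dl0 h]; exists dl => // u u0 us.
rewrite distrC; apply: h; first by rewrite /ball/= distrC.
by rewrite /= in_itv/= u0.
Qed.

End paths.

Section liminf_event.
Context {R : realType} d {T : measurableType d} (P : probability T R).

(** The event is the limit inferior of the [D n]: an increasing union of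
intersections, each of probability at most [b]. *)
Lemma measure_eventually_le (D : nat -> set T) (b : \bar R) :
  (forall n, measurable (D n)) -> (forall n, (P (D n) <= b)%E) ->
  exists E : set T, [/\ measurable E, (P E <= b)%E &
    forall w, (\forall n \near \oo, D n w) -> E w].
Proof.
move=> mD Db.
pose F M := \bigcap_(n in [set n | (M <= n)%N]) D n.
have mF M : measurable (F M) by exact: bigcap_measurableType.
have mU : measurable (\bigcup_M F M) by exact: bigcupT_measurable.
exists (\bigcup_M F M); split=> //.
have ndF : {homo F : n m / (n <= m)%N >-> (n <= m)%O}.
  move=> n m nm; apply/subsetPset => w h k /= mk; apply: h => /=.
  exact: leq_trans mk.
have cF : (P \o F) M @[M --> \oo] --> P (\bigcup_M F M) by exact: nondecreasing_cvg_mu.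
rewrite -(cvg_lim _ cF)//; apply: lime_le; first by apply/cvg_ex; eexists; exact: cF.
near=> M; apply: le_trans (Db M); apply: le_measure; rewrite ?inE//.
by move=> w; apply => /=.
Unshelve. all: by end_near.
Qed.

End liminf_event.

Section brownian_noise.
Context {R : realType} d {T : measurableType d} (P : probability T R).

Lemma measurable_increment (B : R -> T -> R) s t :
  measurable_fun setT (B s) -> measurable_fun setT (B t) ->
  measurable_fun setT (increment B s t).
Proof. by move=> ms mt; exact: measurable_realfun.measurable_funB. Qed.

Section law.
Context (X : T -> R) (s : R).
Hypothesis mX : @measurable_fun _ _ T (measurableTypeR R) setT X.
Hypothesis s0 : s != 0.
Hypothesis lawX : forall A, measurable A -> P (X @^-1` A) = normal_prob 0 s A.

Lemma integral_normal_law (f : R -> \bar R) :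
  (\int[image_measure P mX]_x f x = \int[normal_prob 0 s]_x f x)%E.
Proof. by apply: eq_measure_integral => A mA _; exact: lawX. Qed.

Lemma normal_law_moment2 : (\int[P]_w (X w ^+ 2)%:E <= (8 * s ^+ 2)%:E)%E.
Proof.
apply: le_trans (normal_prob_moment2 s0).
rewrite -integral_normal_law ge0_integral_pushforward//.
- by apply/measurable_EFinP; exact: measurable_realfun.measurable_funX.
- by move=> x _; rewrite lee_fin sqr_ge0.
Qed.

Lemma normal_law_integrable : P.-integrable setT (EFin \o X).
Proof.
apply/integrableP; split; first exact/measurable_EFinP.
have /integrableP[_] := integrable_normal_prob_id s0.
by rewrite -integral_normal_law ge0_integral_pushforward//; exact: measurableT_comp.
Qed.

Lemma normal_law_mean : (\int[P]_w (X w)%:E = 0)%E.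
Proof.
rewrite -(normal_prob_mean s0) -integral_normal_law integral_pushforward//.
exact: normal_law_integrable.
Qed.

End law.

(** Brownian motion relative to a filtration possibly larger than its own. *)
Record brownian_motion_wrt (F : R -> set_system T) (B : R -> T -> R) : Prop := {
  bmw_bm : brownian_motion P B ;
  bmw_sub : forall s, 0 <= s -> <<s F s >> `<=` measurable ;
  bmw_incr : forall s t, 0 <= s <= t -> <<s F s >> `<=` <<s F t >> ;
  bmw_adapted : forall s, 0 <= s -> meas_wrt (F s) (B s) ;
  bmw_indep : forall s t, 0 <= s < t -> indep_of P (F s) (increment B s t) }.

Lemma indep_of_cst (G : set_system T) (x : R) : <<s G >> `<=` measurable ->
  indep_of P G (cst x).
Proof.
move=> GT E A GE mA; rewrite preimage_cst; case: ifPn => _.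
  by rewrite setIT probability_setT mule1.
by rewrite setI0 measure0 mule0.
Qed.

(** The factor 8 is that of [normal_prob_moment2]. When two consecutive times
coincide the increment is constant, a case that the Gaussian bounds exclude. *)
Lemma brownian_noise F B (n : nat) (r : nat -> R) : brownian_motion_wrt F B ->
  0 <= r 0 -> (forall j, (j < n)%N -> r j <= r j.+1) ->
  noise P n (fun j => F (r j)) (fun j => increment B (r j) (r j.+1))
    (fun j => 8 * (r j.+1 - r j)).
Proof.
move=> BF r0 rS.
have rge0 j : (j <= n)%N -> 0 <= r j.
  elim: j => // j IH jn; apply: le_trans (rS _ jn); exact: IH (ltnW jn).
have mB j : (j <= n)%N -> measurable_fun setT (B (r j)).
  by move=> jn; apply: bm_measurable (bmw_bm BF) _ _; exact: rge0.
have mI j : (j < n)%N -> measurable_fun setT (increment B (r j) (r j.+1)).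
  by move=> jn; apply: measurable_increment; apply: mB => //; exact: ltnW.
have sub j : (j < n)%N -> <<s F (r j) >> `<=` <<s F (r j.+1) >>.
  by move=> jn; apply: (bmw_incr BF); rewrite rge0 ?rS// ltnW.
have cst0 j : r j = r j.+1 -> increment B (r j) (r j.+1) = cst 0.
  by move=> e; apply/funext => w; rewrite /increment -e subrr.
have law j : (j < n)%N -> r j != r j.+1 -> forall A, measurable A ->
    P (increment B (r j) (r j.+1) @^-1` A) =
    normal_prob 0 (Num.sqrt (r j.+1 - r j)) A.
  move=> jn ne A mA; apply: (bm_normal (bmw_bm BF)) => //.
  by rewrite rge0 ?(ltnW jn)// lt_neqAle ne rS.
have nz j : (j < n)%N -> r j != r j.+1 -> Num.sqrt (r j.+1 - r j) != 0.
  by move=> jn ne; rewrite gt_eqF// sqrtr_gt0 subr_gt0 lt_neqAle ne rS.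
split.
- by move=> j jn; apply: (bmw_sub BF); exact: rge0.
- exact: sub.
- move=> j jn; apply: measurable_realfun.measurable_funB.
    by apply: (bmw_adapted BF); exact: rge0.
  apply: (meas_wrt_sub (sub _ jn)); apply: (bmw_adapted BF).
  exact: rge0 (ltnW jn).
- move=> j jn; have [e|ne] := eqVneq (r j) (r j.+1).
    rewrite cst0//; apply: indep_of_cst; apply: (bmw_sub BF).
    exact: rge0 (ltnW jn).
  by apply: (bmw_indep BF); rewrite rge0 ?(ltnW jn)// lt_neqAle ne rS.
- move=> j jn; have [e|ne] := eqVneq (r j) (r j.+1).
    by rewrite cst0//; exact: finite_measure_integrable_cst.
  exact: (normal_law_integrable (mI _ jn) (nz _ jn ne) (law _ jn ne)).
- move=> j jn; have [e|ne] := eqVneq (r j) (r j.+1).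
    by rewrite cst0// integral0.
  exact: (normal_law_mean (mI _ jn) (nz _ jn ne) (law _ jn ne)).
- move=> j jn; have [e|ne] := eqVneq (r j) (r j.+1).
    rewrite cst0// -e subrr mulr0 integral0_eq// => w _.
    by rewrite expr0n.
  have := normal_law_moment2 (mI _ jn) (nz _ jn ne) (law _ jn ne).
  by rewrite sqr_sqrtr// subr_ge0 rS.
Qed.

End brownian_noise.

Section simple_integral.
Context {R : realType} d {T : measurableType d} (P : probability T R).

Definition simple_integral (n : nat) (t : nat -> R) (k : nat -> T -> R)
    (B : R -> T -> R) (s : R) (w : T) : R :=
  \sum_(i < n) k i w * (B (Num.min s (t i.+1)) w - B (Num.min s (t i)) w).

Section cells.
Context (n : nat) (t : nat -> R).
Hypothesis tS : forall i, (i < n)%N -> t i <= t i.+1.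

Lemma mesh_le i j : (i <= j <= n)%N -> t i <= t j.
Proof.
elim: j => [|j IH] /andP[ij jn]; first by move: ij; rewrite leqn0 => /eqP->.
move: ij; rewrite leq_eqVlt => /orP[/eqP->//|ij].
by apply: le_trans (tS jn); apply: IH; rewrite -ltnS ij ltnW.
Qed.

Lemma simple_integral_cell k B w i (s u : R) : (i < n)%N ->
  t i <= s -> s <= u -> u <= t i.+1 ->
  simple_integral n t k B u w - simple_integral n t k B s w =
  k i w * (B u w - B s w).
Proof.
move=> ni tis su uti; rewrite /simple_integral -sumrB.
rewrite (bigD1 (Ordinal ni))//= big1 => [|[j jn] /= ji].
  rewrite addr0 (min_idPl (le_trans su uti)) (min_idPl uti).
  by rewrite !(min_idPr _)// ?(le_trans tis)//; ring.
have {}ji : j != i by apply: contra ji => /eqP ji; apply/eqP/val_inj.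
move: ji; rewrite neq_ltn => /orP[ji|ij].
  have h1 : t j.+1 <= t i by apply: mesh_le; rewrite ji ltnW.
  have h2 : t j <= t i by apply: mesh_le; rewrite (ltnW ji) ltnW.
  have h3 := le_trans tis su.
  rewrite (min_idPr (le_trans h1 h3)) (min_idPr (le_trans h2 h3)).
  by rewrite (min_idPr (le_trans h1 tis)) (min_idPr (le_trans h2 tis)) subrr.
have h1 : t i.+1 <= t j by apply: mesh_le; rewrite ij ltnW.
have h2 : t i.+1 <= t j.+1 by apply: mesh_le; rewrite (leq_trans ij).
have h3 := le_trans su uti.
rewrite (min_idPl (le_trans uti h1)) (min_idPl (le_trans uti h2)).
rewrite (min_idPl (le_trans h3 h1)) (min_idPl (le_trans h3 h2)).
by rewrite !subrr.
Qed.

Lemma simple_integral_min k B w (s : R) :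
  simple_integral n t k B (Num.min s (t n)) w = simple_integral n t k B s w.
Proof.
apply: eq_bigr => -[i ni] _ /=; rewrite -!minA.
by rewrite !(min_idPr (mesh_le _))// leqnn ?(ltnW ni) ?ni.
Qed.

Lemma cell_exists (s : R) : t 0 <= s <= t n ->
  n = 0%N \/ exists2 i, (i < n)%N & t i <= s <= t i.+1.
Proof.
move: tS; case: n => [|m] tS'; first by left.
move=> h; right; elim: m tS' h => [|m IH] tS' /andP[h0 h1].
  by exists 0%N => //; rewrite h0.
have [sm|ms] := leP s (t m.+1).
  have [|i im hi] := IH _ (introT andP (conj h0 sm)).
    by move=> i im; apply: tS'; exact: ltnW.
  by exists i => //; exact: ltnW.
by exists m.+1 => //; rewrite (ltW ms).
Qed.

End cells.

(** The mesh [t], truncated at the horizon [tau], with each cell cut into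
[q] equal pieces. *)
Definition refine (tau : R) (t : nat -> R) (q j : nat) : R :=
  let c i := Num.min tau (t i) in
  c (j %/ q)%N + (c (j %/ q).+1 - c (j %/ q)%N) * ((j %% q)%:R / q%:R).

Lemma refine_cell tau t q i l : (0 < q)%N -> (l <= q)%N ->
  refine tau t q (i * q + l) = Num.min tau (t i) +
    (Num.min tau (t i.+1) - Num.min tau (t i)) * (l%:R / q%:R).
Proof.
move=> q0; rewrite leq_eqVlt => /orP[/eqP->|lq].
  rewrite -mulSnr /refine mulnK// modnMl mul0r mulr0 addr0.
  by rewrite divff ?mulr1 ?pnatr_eq0 ?gtn_eqF// subrKC.
by rewrite /refine divnMDl// modnMDl divn_small// modn_small// addn0.
Qed.

Lemma refine0 tau t q : refine tau t q 0 = Num.min tau (t 0).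
Proof. by rewrite /refine div0n mod0n mul0r mulr0 addr0. Qed.

Lemma refine_coord q j : (0 < q)%N -> exists i l,
  [/\ i = (j %/ q)%N, j = (i * q + l)%N & (l < q)%N].
Proof. by move=> q0; exists (j %/ q)%N, (j %% q)%N; rewrite -divn_eq ltn_mod. Qed.

Section refined.
Context (n : nat) (t : nat -> R) (tau : R) (q : nat).
Hypothesis tS : forall i, (i < n)%N -> t i <= t i.+1.
Hypothesis q0 : (0 < q)%N.
Local Notation r := (refine tau t q).

Lemma cut_le i : (i < n)%N -> Num.min tau (t i) <= Num.min tau (t i.+1).
Proof. by move=> ni; rewrite le_min ge_min lexx/= ge_min tS// orbT. Qed.

Lemma refine_bounds i l : (i < n)%N -> (l <= q)%N ->
  Num.min tau (t i) <= r (i * q + l)%N <= Num.min tau (t i.+1).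
Proof.
move=> ni lq; rewrite (refine_cell _ _ _ q0 lq).
have qR : 0 < q%:R :> R by rewrite ltr0n.
have x0 : 0 <= l%:R / q%:R :> R by rewrite divr_ge0.
have x1 : l%:R / q%:R <= 1 :> R by rewrite ler_pdivrMr// mul1r ler_nat.
by have := cut_le ni; nra.
Qed.

Lemma refine_le j : (j < n * q)%N -> r j <= r j.+1.
Proof.
have [i [l [_ -> lq]]] := refine_coord j q0; move=> jN.
have ni : (i < n)%N.
  by rewrite -(ltn_pmul2r q0); apply: leq_ltn_trans jN; exact: leq_addr.
rewrite -addnS (refine_cell _ _ _ q0 (ltnW lq)) (refine_cell _ _ _ q0 lq).
rewrite lerD2l ler_wpM2l ?subr_ge0 ?cut_le//.
by rewrite ler_pM2r ?invr_gt0 ?ltr0n// ler_nat.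
Qed.

Lemma refine_div j : (j < n * q)%N ->
  Num.min tau (t (j %/ q)%N) <= r j /\ r j.+1 <= Num.min tau (t (j %/ q).+1).
Proof.
move=> jN; have ni : (j %/ q < n)%N by rewrite ltn_divLR.
have /andP[h1 _] := refine_bounds ni (ltnW (ltn_pmod j q0)).
have /andP[_ h2] := refine_bounds ni (ltn_pmod j q0).
by move: h2; rewrite addnS; move: h1; rewrite -divn_eq.
Qed.

Lemma refine_last : r (n * q)%N <= tau.
Proof.
case: n (@refine_bounds) => [|n'] rc.
  by rewrite mul0n refine0 ge_min lexx.
have /andP[_] := rc n' q (ltnSn _) (leqnn _).
by rewrite -mulSnr le_min => /andP[].
Qed.

Lemma refine_dense i s : (i < n)%N -> 0 <= Num.min tau (t i) ->
  Num.min tau (t i) <= s <= Num.min tau (t i.+1) ->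
  exists2 l, (l <= q)%N & `|r (i * q + l)%N - s| <= tau / q%:R.
Proof.
move=> ni t0 /andP[cs sc].
pose L := Num.min tau (t i.+1) - Num.min tau (t i).
have qR : 0 < q%:R :> R by rewrite ltr0n.
have L0 : 0 <= L by rewrite subr_ge0 cut_le.
have ti : Num.min tau (t i.+1) <= tau by rewrite ge_min lexx.
have tau0 : 0 <= tau by lra.
have [Le|Ln] := eqVneq L 0.
  exists 0%N => //; rewrite refine_cell// mul0r mulr0 addr0.
  have -> : Num.min tau (t i) = s by move: Le cs sc; rewrite /L; lra.
  by rewrite subrr normr0; apply: divr_ge0 => //; exact: ltW.
have Lgt : 0 < L by rewrite lt_neqAle eq_sym Ln.
pose x := (s - Num.min tau (t i)) / L * q%:R.
have d0 : 0 <= s - Num.min tau (t i) by rewrite subr_ge0.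
have x0 : 0 <= x := mulr_ge0 (divr_ge0 d0 L0) (ltW qR).
have xq : x <= q%:R.
  by rewrite /x ler_piMl ?(ltW qR)// ler_pdivrMr// mul1r /L; lra.
have /andP[xl xr] := truncn_itv x0.
have lq : (Num.trunc x <= q)%N by rewrite -(ler_nat R); exact: le_trans xl xq.
exists (Num.trunc x) => //; rewrite (refine_cell _ _ _ q0 lq) -/L.
have -> : s = Num.min tau (t i) + L * (x / q%:R).
  by rewrite /x mulfK ?gt_eqF// mulrC divfK//; ring.
rewrite opprD addrACA subrr add0r -mulrBr -mulrBl normrM (ger0_norm L0).
rewrite normrM [`|_^-1|]ger0_norm ?invr_ge0 ?(ltW qR)// mulrA.
rewrite ler_pM2r ?invr_gt0//.
have h1 : `|(Num.trunc x)%:R - x| <= 1.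
  by rewrite ler_norml; move: xl xr; rewrite -natr1; lra.
have h2 : L <= tau by rewrite /L; lra.
by rewrite -[leRHS]mulr1 ler_pM.
Qed.

End refined.

(** The second moment bound only sees the total variance [tau] of the noise, not
the number [q] of pieces of each cell. *)
Lemma simple_integral_grid_maximal (F : R -> set_system T) (B : R -> T -> R)
    (n : nat) (t : nat -> R) (k : nat -> T -> R) (tau c a : R) (q : nat) :
  brownian_motion_wrt P F B -> 0 < tau -> 0 < a -> 0 <= c -> t 0 = 0 ->
  (forall i, (i < n)%N -> t i <= t i.+1) ->
  (forall i, (i < n)%N -> t i < tau -> meas_wrt (F (t i)) (k i)) ->
  (forall i w, (i < n)%N -> `|k i w| <= c) -> (0 < q)%N ->
  exists E : set T, [/\ measurable E,
    (P E <= (c ^+ 2 * (8 * tau) / a ^+ 2)%:E)%E &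
    forall w j, (j <= n * q)%N ->
      a < `|simple_integral n t k B (refine tau t q j) w| -> E w].
Proof.
move=> BF tau0 a0 c0 t0 tS mk kc q0.
have tge0 i : (i <= n)%N -> 0 <= t i.
  by move=> ni; rewrite -t0; apply: (mesh_le tS); rewrite leq0n.
set r := refine tau t q.
pose k' j w := if t (j %/ q)%N < tau then k (j %/ q)%N w else 0.
have r0 : r 0 = 0 by rewrite /r refine0 t0 (min_idPr (ltW tau0)).
have rS j : (j < n * q)%N -> r j <= r j.+1 by exact: refine_le.
have r00 : 0 <= r 0 by rewrite r0.
have nX := brownian_noise BF r00 rS.
have jn j : (j < n * q)%N -> (j %/ q < n)%N by move=> jN; rewrite ltn_divLR.
have mk' j : (j < n * q)%N -> meas_wrt (F (r j)) (k' j).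
  move=> jN; have ni := jn _ jN.
  have [h|h] := boolP (t (j %/ q)%N < tau); last first.
    rewrite (_ : k' j = cst 0); first exact: measurable_cst.
    by apply/funext => w; rewrite /k' (negbTE h).
  rewrite (_ : k' j = k (j %/ q)%N); last first.
    by apply/funext => w; rewrite /k' h.
  apply: (meas_wrt_sub _ (mk _ ni h)); apply: (bmw_incr BF).
  rewrite tge0 ?(ltnW ni)//=.
  by have [] := refine_div tau tS q0 jN; rewrite (min_idPr (ltW h)).
have kc' j w : (j < n * q)%N -> `|k' j w| <= c.
  move=> jN; rewrite /k'; case: ifPn => _; last by rewrite normr0.
  exact: kc (jn _ jN).
have step j w : (j < n * q)%N ->
    simple_integral n t k B (r j.+1) w - simple_integral n t k B (r j) w =
    k' j w * increment B (r j) (r j.+1) w.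
  move=> jN; have ni := jn _ jN; rewrite /increment.
  have [h1 h2] := refine_div tau tS q0 jN; have h3 := rS _ jN.
  rewrite /k'; case: ifPn => h; last first.
    rewrite -leNgt in h; have h' := le_trans h (tS _ ni).
    rewrite (min_idPl h) in h1; rewrite (min_idPl h') in h2.
    have -> : r j = r j.+1 by apply/le_anti; rewrite h3/= (le_trans h2 h1).
    by rewrite !subrr mul0r.
  rewrite (min_idPr (ltW h)) in h1; apply: (simple_integral_cell tS) => //.
  by apply: le_trans h2 _; rewrite ge_min lexx orbT.
have S0 w : simple_integral n t k B (r 0) w = 0.
  rewrite r0; apply: big1 => -[i ni] _ /=.
  by rewrite !(min_idPl (tge0 _ _)) ?subrr ?mulr0// ltnW.
have StE j w : (j <= n * q)%N ->
    transform k' (fun j => increment B (r j) (r j.+1)) j w =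
    simple_integral n t k B (r j) w.
  elim: j => [_|j IH jN]; first by rewrite S0 /transform big_ord0.
  by rewrite transformS IH 1?ltnW// -step// subrKC.
have [E [mE PE hE]] := transform_maximal nX mk' kc' a0.
exists E; split => //; last first.
  by move=> w j jN h; apply: (hE w j jN); rewrite StE.
apply: le_trans PE _; rewrite lee_fin ler_wpM2r ?invr_ge0 ?sqr_ge0//.
rewrite ler_wpM2l ?sqr_ge0// -mulr_sumr ler_wpM2l//.
rewrite -(big_mkord xpredT (fun j => r j.+1 - r j)) telescope_sumr// r0 subr0.
exact: refine_last.
Qed.

(** By continuity, a path along which the integral exceeds [a] exceeds it on
every fine enough grid, so that it lies in all but finitely many of the
exceptional events of the grids. *)
Lemma simple_integral_maximal (F : R -> set_system T) (B : R -> T -> R)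
    (n : nat) (t : nat -> R) (k : nat -> T -> R) (tau c a : R) :
  brownian_motion_wrt P F B -> 0 < tau -> 0 < a -> 0 <= c -> t 0 = 0 ->
  (forall i, (i < n)%N -> t i <= t i.+1) ->
  (forall i, (i < n)%N -> t i < tau -> meas_wrt (F (t i)) (k i)) ->
  (forall i w, (i < n)%N -> `|k i w| <= c) ->
  exists E : set T, [/\ measurable E,
    (P E <= (c ^+ 2 * (8 * tau) / a ^+ 2)%:E)%E &
    forall w s, 0 <= s <= tau -> a < `|simple_integral n t k B s w| -> E w].
Proof.
move=> BF tau0 a0 c0 t0 tS mk kc.
have tge0 i : (i <= n)%N -> 0 <= t i.
  by move=> ni; rewrite -t0; apply: (mesh_le tS); rewrite leq0n.
have [D hD] := choice (fun m =>
  simple_integral_grid_maximal BF tau0 a0 c0 t0 tS mk kc (ltn0Sn m)).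
have mD m : measurable (D m) by have [] := hD m.
have PD m : (P (D m) <= (c ^+ 2 * (8 * tau) / a ^+ 2)%:E)%E by have [] := hD m.
have [E [mE PE hE]] := measure_eventually_le mD PD.
exists E; split => // w s /andP[s0 stau] aS; apply: hE.
rewrite -(simple_integral_min tS) in aS; set s1 := Num.min s (t n) in aS.
have s1s : s1 <= s by rewrite ge_min lexx.
have s10 : 0 <= s1 by rewrite le_min s0 tge0.
have [n0|[i ni /andP[tis sti]]] : n = 0%N \/ exists2 i, (i < n)%N & t i <= s1 <= t i.+1.
- by apply: (cell_exists tS); rewrite t0 s10/= ge_min lexx orbT.
- by move: aS; rewrite /simple_integral n0 big_ord0 normr0 ltNge (ltW a0).
have cs : Num.min tau (t i) <= s1 by rewrite ge_min tis orbT.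
have sc : s1 <= Num.min tau (t i.+1) by rewrite le_min sti (le_trans s1s).
have ci : 0 <= Num.min tau (t i) by rewrite le_min (ltW tau0) tge0// ltnW.
have c1 : 0 < c + 1 by rewrite ltr_wpDl.
pose e := (`|simple_integral n t k B s1 w| - a) / (c + 1).
have e0 : 0 < e by rewrite divr_gt0// subr_gt0.
have cB : continuous_paths B by exact: bm_continuous (bmw_bm BF).
have [dl dl0 hdl] := continuous_path_at (cB w) s10 e0.
have ev : \forall m \near \oo, tau / m.+1%:R < dl.
  near=> m; rewrite ltr_pdivrMr// mulrC -ltr_pdivrMr//.
  apply: (@lt_trans _ _ m%:R); last by rewrite ltr_nat.
  by near: m; exact: nbhs_infty_gtr.
near=> m.
have csc : Num.min tau (t i) <= s1 <= Num.min tau (t i.+1) by rewrite cs sc.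
have [l lq hl] := refine_dense tS (ltn0Sn m) ni ci csc.
have /andP[g1 g2] := refine_bounds tau tS (ltn0Sn m) ni lq.
have [_ _ hDm] := hD m; apply: (hDm w (i * m.+1 + l)%N).
  apply: leq_trans (leq_add (leqnn _) lq) _.
  by rewrite -mulSnr leq_mul2r ni orbT.
set g := refine _ _ _ _ in hl g1 g2 *.
have titau : t i <= tau by apply: le_trans tis (le_trans s1s stau).
have tig : t i <= g by rewrite (min_idPr titau) in g1.
have gti : g <= t i.+1 by apply: le_trans g2 _; rewrite ge_min lexx orbT.
have g0 : 0 <= g := le_trans ci g1.
have diff : simple_integral n t k B g w - simple_integral n t k B s1 w =
    k i w * (B g w - B s1 w).
  have [gs|/ltW sg] := leP g s1; last exact: (simple_integral_cell tS).
  apply: oppr_inj; rewrite opprB -mulrN opprB.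
  exact: (simple_integral_cell tS).
have dB : `|B g w - B s1 w| < e.
  apply: hdl => //; apply: le_lt_trans hl _; near: m; exact: ev.
have : `|simple_integral n t k B g w - simple_integral n t k B s1 w| <= c * e.
  by rewrite diff normrM ler_pM ?kc// ltW.
have ce : c * e < `|simple_integral n t k B s1 w| - a.
  have -> : `|simple_integral n t k B s1 w| - a = (c + 1) * e.
    by rewrite mulrC divfK// gt_eqF.
  by rewrite ltr_pM2r// ltrDl.
have := ler_distD 0 (simple_integral n t k B s1 w) (simple_integral n t k B g w).
have := lerB_dist (simple_integral n t k B s1 w) (simple_integral n t k B g w).
rewrite distrC; lra.
Unshelve. all: by end_near.
Qed.

End simple_integral.

(** * Planar Brownian motion and its natural filtration *)

Section filtration.
Context {R : realType} d {T : measurableType d} (P : probability T R).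

Section process_sigma.
Context d' {V : measurableType d'} (X : R -> T -> V).

Lemma process_sigma_algebra J : sigma_algebra setT (process_sigma X J).
Proof. exact: smallest_sigma_algebra. Qed.

Lemma process_sigma_id J : <<s process_sigma X J >> = process_sigma X J.
Proof. exact: sigma_algebra_id (process_sigma_algebra J). Qed.

Lemma process_sigmaT J : process_sigma X J setT.
Proof. exact: (@measurableT _ (g_sigma_algebraType _)). Qed.

Lemma process_sigmaI J E1 E2 : process_sigma X J E1 -> process_sigma X J E2 ->
  process_sigma X J (E1 `&` E2).
Proof. exact: (@measurableI _ (g_sigma_algebraType _)). Qed.

Lemma process_sigma_preimage (J : set R) u B : J u -> measurable B ->
  process_sigma X J (X u @^-1` B).
Proof.
move=> Ju mB; apply: sub_gen_smallest; exists u => //.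
by exists B => //; rewrite setTI.
Qed.

Lemma process_sigma_min (J : set R) (G : set_system T) : sigma_algebra setT G ->
  (forall u B, J u -> measurable B -> G (X u @^-1` B)) ->
  process_sigma X J `<=` G.
Proof.
move=> sG h; apply: smallest_sub => // E [u Ju [B mB <-]].
by rewrite setTI; exact: h.
Qed.

Lemma process_sigma_subset (J J' : set R) : J `<=` J' ->
  process_sigma X J `<=` process_sigma X J'.
Proof.
move=> JJ'; apply: process_sigma_min; first exact: process_sigma_algebra.
by move=> u B /JJ' Ju mB; exact: process_sigma_preimage.
Qed.

Lemma process_sigma_measurable (J : set R) :
  (forall u, J u -> measurable_fun setT (X u)) ->
  process_sigma X J `<=` measurable.
Proof.
move=> mX; apply: process_sigma_min; first exact: sigma_algebra_measurable.
by move=> u B Ju mB; rewrite -[X in measurable X]setTI; exact: mX.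
Qed.

End process_sigma.

Lemma itv0_le (s : R) : (`[0, s]%classic : set R) `<=` `[0, +oo[%classic.
Proof. by move=> u /=; rewrite !in_itv/= => /andP[->]. Qed.

Section enlarge.
(* [V] is the pair of [X] and [Y], in either order, and [p] its projection on
   [X]. *)
Context (X Y : R -> T -> R) (V : R -> T -> R * R) (p : R * R -> R).
Hypotheses (bX : brownian_motion P X) (bY : brownian_motion P Y).
Hypothesis XY : independent_processes P X Y.
Hypothesis mp : measurable_fun setT p.
Hypothesis VX : forall u w, X u w = p (V u w).
Hypothesis VXY : forall (G : set_system T) u, meas_wrt G (X u) ->
  meas_wrt G (Y u) ->
  measurable_fun [set: g_sigma_algebraType G] (V u : g_sigma_algebraType G -> R * R).

Lemma enlarged_preimage (G : set_system T) u B : meas_wrt G (X u) ->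
  meas_wrt G (Y u) -> measurable B -> <<s G >> (V u @^-1` B).
Proof. by move=> mX mY mB; have := VXY mX mY measurableT mB; rewrite setTI. Qed.

Lemma meas_wrt_measurable_fun (f : T -> R) : measurable_fun setT f ->
  meas_wrt measurable f.
Proof.
move=> mf; apply/meas_wrtP => A mA; apply: sub_gen_smallest.
by rewrite -[X in measurable X]setTI; exact: mf.
Qed.

Let pi_system (s : R) : set_system T :=
  [set E | exists E1 E2, [/\ process_sigma X `[0, s] E1,
     process_sigma Y `[0, +oo[ E2 & E = E1 `&` E2]].

(** The increment is independent of the past of [X], and of the whole of [Y]
jointly with [X]; intersections of such events form a pi-system generating a
sigma-algebra that contains the past of the pair. *)
Lemma enlarged_indep s t : 0 <= s < t ->
  indep_of P (natural_filtration V s) (increment X s t).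
Proof.
move=> /[dup] st /andP[s0 slt] E A; rewrite process_sigma_id => FE mA.
have t0 : 0 <= t := le_trans s0 (ltW slt).
have mX u : 0 <= u -> measurable_fun setT (X u) by exact: bm_measurable bX _.
have mY u : 0 <= u -> measurable_fun setT (Y u) by exact: bm_measurable bY _.
have ge0 (u a : R) : `[0, a]%classic u -> 0 <= u by rewrite /= in_itv/= => /andP[].
have ge0y (u : R) : `[0, +oo[%classic u -> 0 <= u by rewrite /= in_itv/= andbT.
have mSX (a : R) : process_sigma X `[0, a] `<=` measurable.
  by apply: process_sigma_measurable => u /ge0; exact: mX.
have mSY : process_sigma Y `[0, +oo[ `<=` measurable.
  by apply: process_sigma_measurable => u /ge0y; exact: mY.
set D := increment X s t @^-1` A.
have SXX (a : R) : process_sigma X `[0, a] `<=` process_sigma X `[0, +oo[.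
  by apply: process_sigma_subset; exact: itv0_le.
have SD : process_sigma X `[0, +oo[ D.
  rewrite -process_sigma_id; apply/meas_wrtP: A mA @D => //.
  apply: measurable_realfun.measurable_funB; apply/meas_wrtP => A mA;
    apply: sub_gen_smallest; apply: process_sigma_preimage => //;
    by rewrite /= in_itv/= andbT.
have mD : measurable D.
  by apply: process_sigma_measurable SD => u /ge0y; exact: mX.
have PDf : P D \is a fin_num by exact: fin_num_measure.
have PD0 : 0 <= fine (P D) by exact: fine_ge0.
pose m1 := mrestr P mD.
pose m2 := mscale (NngNum PD0) P.
have KT : pi_system s setT.
  by exists setT, setT; split; [exact: process_sigmaT|exact: process_sigmaT|rewrite setIT].
have Kmeas : pi_system s `<=` measurable.
  by move=> _ [E1 [E2 [/mSX m1' /mSY m2' ->]]]; exact: measurableI.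
have KI : setI_closed (pi_system s).
  move=> _ _ [E1 [E2 [h1 h2 ->]]] [E1' [E2' [h1' h2' ->]]].
  exists (E1 `&` E1'), (E2 `&` E2'); split; [exact: process_sigmaI|exact: process_sigmaI|].
  by rewrite setIACA.
have K12 B : pi_system s B -> m1 B = m2 B.
  move=> [E1 [E2 [h1 h2 ->]]]; rewrite /m1 /m2 /mrestr /mscale /= fineK//.
  rewrite setIAC (XY (process_sigmaI (SXX _ _ h1) SD) h2) (XY (SXX _ _ h1) h2).
  by rewrite (bm_indep bX st h1 mA) -/D muleAC muleC.
have FK : natural_filtration V s `<=` <<s pi_system s >>.
  apply: process_sigma_min; first exact: smallest_sigma_algebra.
  move=> u B us mB; apply: enlarged_preimage => //; apply/meas_wrtP => C mC;
    apply: sub_gen_smallest.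
  + exists (X u @^-1` C), setT; split; last by rewrite setIT.
      exact: process_sigma_preimage.
    exact: process_sigmaT.
  + exists setT, (Y u @^-1` C); split; last by rewrite setTI.
      exact: process_sigmaT.
    by apply: process_sigma_preimage => //; exact: itv0_le us.
have cov : \bigcup_(k in [set: nat]) [set: T] = [set: T].
  by apply: bigcup_const; exists 0%N.
have fin (k : nat) : (m1 setT < +oo)%E.
  by rewrite /m1 /mrestr /= setTI ltey_eq PDf.
have E12 : m1 E = m2 E := g_sigma_algebra_measure_unique (pi_system s) Kmeas
  (fun=> setT) (fun=> KT) cov m1 m2 KI K12 fin E (FK _ FE).
transitivity (m2 E); first by rewrite -E12.
by rewrite /m2 /mscale /= fineK// muleC.
Qed.

Lemma brownian_motion_wrt_pair : brownian_motion_wrt P (natural_filtration V) X.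
Proof.
have mV u : 0 <= u -> measurable_fun setT (V u).
  move=> u0 _ B mB; rewrite setTI.
  rewrite -(sigma_algebra_id (sigma_algebra_measurable T)).
  by apply: enlarged_preimage => //; apply: meas_wrt_measurable_fun;
    [exact: bm_measurable bX _ u0|exact: bm_measurable bY _ u0].
split => //.
- move=> s s0; rewrite process_sigma_id; apply: process_sigma_measurable => u.
  by rewrite /= in_itv/= => /andP[u0 _]; exact: mV.
- move=> s t /andP[s0 st]; rewrite !process_sigma_id; apply: process_sigma_subset.
  by move=> u; rewrite /= !in_itv/= => /andP[-> /le_trans->].
- move=> s s0; apply/meas_wrtP => A mA; rewrite process_sigma_id.
  rewrite (_ : X s @^-1` A = V s @^-1` (p @^-1` A)); last first.
    by apply/seteqP; split => w /=; rewrite VX.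
  apply: process_sigma_preimage; first by rewrite /= in_itv/= s0 lexx.
  by rewrite -[X in measurable X]setTI; exact: mp.
- exact: enlarged_indep.
Qed.

End enlarge.

Lemma independent_processes_sym (X Y : R -> T -> R) :
  independent_processes P X Y -> independent_processes P Y X.
Proof. by move=> h E F hE hF; rewrite setIC h// muleC. Qed.

Lemma planar_brownian_motion_wrt (W : R -> T -> R[i]) :
  planar_brownian_motion P W ->
  brownian_motion_wrt P (natural_filtration (fun t w => cpair (W t w))) (Re_process W) /\
  brownian_motion_wrt P (natural_filtration (fun t w => cpair (W t w))) (Im_process W).
Proof.
move=> [bX bY XY]; split.
  apply: (brownian_motion_wrt_pair (p := fst) bX bY XY) => //.
  by move=> G u mX mY; exact: measurable_fun_pair.
apply: (brownian_motion_wrt_pair (p := snd) bY bX _) => //.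
- exact: independent_processes_sym.
- by move=> G u mX mY; exact: measurable_fun_pair.
Qed.

End filtration.

(** * Comparison of the elementary integrals of 1/Z with the driving motion *)

Section modulus.
Context {R : realType}.
Local Notation normc := Normc.normc.
Implicit Types z : R[i].

Lemma normc_norm z : `|z| = (normc z)%:C.
Proof. by case: z. Qed.

Lemma normc_ge0 z : 0 <= normc z.
Proof. by case: z => a b; exact: sqrtr_ge0. Qed.

Lemma normcD z z' : normc (z + z') <= normc z + normc z'.
Proof. exact: le_normcD. Qed.

Lemma normcN z : normc (- z) = normc z.
Proof. by case: z => a b /=; rewrite !sqrrN. Qed.

Lemma Re_le_normc z : `|complex.Re z| <= normc z.
Proof. by rewrite -lecR -normc_norm; exact: normc_ge_Re. Qed.

Lemma Im_le_normc z : `|complex.Im z| <= normc z.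
Proof.
case: z => a b /=; rewrite -sqrtr_sqr ler_sqrt ?lerDr ?sqr_ge0//.
by rewrite addr_ge0 ?sqr_ge0.
Qed.

Lemma normc_le_ReIm z : normc z <= `|complex.Re z| + `|complex.Im z|.
Proof.
case: z => a b /=; rewrite -[leRHS]ger0_norm ?addr_ge0// -sqrtr_sqr.
rewrite ler_sqrt ?sqr_ge0// sqrrD !real_normK ?num_real//.
have := mulr_ge0 (normr_ge0 a) (normr_ge0 b); lra.
Qed.

Lemma ReD z z' : complex.Re (z + z') = complex.Re z + complex.Re z'.
Proof. by case: z; case: z'. Qed.

Lemma ImD z z' : complex.Im (z + z') = complex.Im z + complex.Im z'.
Proof. by case: z; case: z'. Qed.

Lemma ReN z : complex.Re (- z) = - complex.Re z. Proof. by case: z. Qed.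

Lemma ImN z : complex.Im (- z) = - complex.Im z. Proof. by case: z. Qed.

Lemma ImM z z' : complex.Im (z * z') =
  complex.Re z * complex.Im z' + complex.Im z * complex.Re z'.
Proof. by case: z; case: z'. Qed.

Lemma Im_sum n (f : 'I_n -> R[i]) :
  complex.Im (\sum_(i < n) f i) = \sum_(i < n) complex.Im (f i).
Proof. exact: (big_morph _ ImD erefl). Qed.

Lemma normc_inv_sub1 z (e : R) : e <= 2^-1 -> normc (z - 1) <= e ->
  normc (z^-1 - 1) <= 2 * e.
Proof.
move=> e2 ze.
have n1 : normc 1 = 1 :> R by exact: Normc.normc1.
have nz : 2^-1 <= normc z.
  have := normcD (1 - z) z; rewrite subrK n1 -opprB normcN; lra.
have z0 : z != 0.
  apply: contraTneq nz => ->; rewrite Normc.normc0 -ltNge; lra.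
have -> : z^-1 - 1 = (- (z - 1)) * z^-1 by rewrite opprB mulrBl mul1r divff.
rewrite Normc.normcM normcN Normc.normcV.
rewrite ler_pdivrMr ?(lt_le_trans _ nz)//.
by have := normc_ge0 (z - 1); nra.
Qed.

End modulus.

Section path_integral.
Context {R : realType}.

Lemma Rintegral_path_lipschitz (x : R -> R) (M tau s u : R) :
  {within `[0, +oo[, continuous x} ->
  (forall v, 0 <= v <= tau -> `|x v| <= M) -> 0 <= s -> s <= u -> u <= tau ->
  `|\int[lebesgue_measure]_(v in `[0, u]) x v -
    \int[lebesgue_measure]_(v in `[0, s]) x v| <= M * (u - s).
Proof.
move=> cx xM s0 su utau.
have ix : lebesgue_measure.-integrable `[0, u] (EFin \o x).
  apply: continuous_compact_integrable; first exact: segment_compact.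
  apply: continuous_subspaceW cx => v /=.
  by rewrite !in_itv/= => /andP[->].
rewrite Rintegral_itvB// ?bnd_simp//.
have ix' : lebesgue_measure.-integrable `]s, u] (EFin \o x).
  apply: integrableS ix => // v /=; rewrite !in_itv/= => /andP[sv ->].
  by rewrite (le_trans s0 (ltW sv)).
apply: le_trans (le_normr_Rintegral _ _) _ => //.
have -> : M * (u - s) = \int[lebesgue_measure]_(v in `]s, u]) M.
  rewrite Rintegral_cst//= lebesgue_measure_itv/= lte_fin.
  case: ltP => [su'|us]; first by rewrite -EFinD.
  by have -> : u = s by [apply/le_anti; rewrite us su]; rewrite subrr.
apply: le_Rintegral => //=.
- apply/integrableP; split.
    apply/measurable_EFinP; apply: measurableT_comp => //.
    by apply/measurable_EFinP; exact: measurable_int ix'.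
  move/integrableP : ix' => [_].
  by under eq_integral do rewrite /= -[`|x _|]normr_id.
- apply/integrableP; split; first exact: measurable_cst.
  rewrite integral_cst//= lebesgue_measure_itv/= lte_fin.
  by case: ifPn => _; rewrite ?mule0// -EFinD -EFinM ltry.
- move=> v; rewrite in_itv/= => /andP[sv vu]; apply: xM.
  by rewrite (le_trans s0 (ltW sv))/= (le_trans vu).
Qed.

End path_integral.

Section oscillation.
Context {R : realType} d {T : measurableType d} (P : probability T R).

(** The oscillation events decrease to the empty set with the horizon, by
continuity at 0. They are measurable because the supremum may be taken over the
rational multiples of the horizon. *)
Lemma small_time_oscillation (X : R -> T -> R) (e kappa : R) :
  (forall t, 0 <= t -> measurable_fun setT (X t)) -> continuous_paths X ->
  0 < e -> 0 < kappa -> exists2 tau : R, 0 < tau &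
    exists E : set T, [/\ measurable E, (P E <= kappa%:E)%E &
      forall w u, 0 <= u <= tau -> e < `|X u w - X 0 w| -> E w].
Proof.
move=> mX cX e0 kappa0.
pose tau m : R := m.+1%:R^-1.
have tau0 m : 0 < tau m by rewrite invr_gt0.
pose g m a b : R := tau m * (a%:R / b.+1%:R).
have g0 m a b : 0 <= g m a b 
  by exact: mulr_ge0 (ltW (tau0 m)) (divr_ge0 (ler0n _ _) (ler0n _ _)).
pose D m := [set w | exists2 u, 0 <= u <= tau m & e < `|X u w - X 0 w|].
have DE m : D m = \bigcup_b \bigcup_(a in [set a | (a <= b.+1)%N])
    [set w | e < `|X (g m a b) w - X 0 w|].
  apply/seteqP; split => w /=; last first.
    move=> [b _ [a /= ab h]]; exists (g m a b) => //; rewrite g0/=.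
    by rewrite /g ler_piMr ?(ltW (tau0 m))// ler_pdivrMr// mul1r ler_nat.
  move=> [u /andP[u0 ut] h].
  have e1 : 0 < `|X u w - X 0 w| - e by rewrite subr_gt0.
  have [dl dl0 hdl] := continuous_path_at (cX w) u0 e1.
  have [b hb] : exists b : nat, tau m / dl < b.+1%:R.
    exists (Num.trunc (tau m / dl)).
    by have /andP[] := truncn_itv (ltW (divr_gt0 (tau0 m) dl0)).
  exists b => //.
  pose x := u / tau m * b.+1%:R.
  have x0 : 0 <= x := mulr_ge0 (divr_ge0 u0 (ltW (tau0 m))) (ler0n _ _).
  have xb : x <= b.+1%:R.
    by rewrite /x ler_piMl// ler_pdivrMr// mul1r.
  have /andP[xl xr] := truncn_itv x0.
  exists (Num.trunc x) => /=; first by rewrite -(ler_nat R); exact: le_trans xl xb.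
  have ug : `|g m (Num.trunc x) b - u| < dl.
    have -> : u = tau m * (x / b.+1%:R).
      by rewrite /x mulfK ?pnatr_eq0// mulrC divfK// gt_eqF.
    rewrite /g -mulrBr -mulrBl normrM gtr0_norm// normrM.
    rewrite [`|_^-1|]gtr0_norm ?invr_gt0// mulrA ltr_pdivrMr//.
    apply: (@le_lt_trans _ _ (tau m * 1)).
      rewrite ler_pM2l// ler_norml; move: xl xr; rewrite -natr1; lra.
    by rewrite mulr1 mulrC -ltr_pdivrMr.
  have := hdl _ (g0 m (Num.trunc x) b) ug.
  have := ler_distD (X (g m (Num.trunc x) b) w) (X u w) (X 0 w).
  by rewrite [`|X u w - X (g _ _ _) w|]distrC; lra.
have mD m : measurable (D m).
  rewrite DE; apply: bigcupT_measurable => b; apply: bigcup_measurable => a _.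
  rewrite (_ : [set _ | _] = (fun w => `|X (g m a b) w - X 0 w|) @^-1` `]e, +oo[).
    rewrite -[X in measurable X]setTI.
    apply: (measurableT_comp (f := fun x : R => `|x|)) => //.
    by apply: measurable_realfun.measurable_funB; exact: mX.
  by apply/seteqP; split => w /=; rewrite in_itv/= andbT.
have D0 : \bigcap_m D m = set0.
  rewrite -subset0 => w Dw.
  have [dl dl0 hdl] := continuous_path_at (cX w) (lexx 0) e0.
  have [m hm] : exists m : nat, dl^-1 < m.+1%:R.
    have idl : 0 <= dl^-1 by rewrite invr_ge0 ltW.
    by exists (Num.trunc dl^-1); have /andP[] := truncn_itv idl.
  have [u /andP[u0 ut]] := Dw m Logic.I.
  rewrite ltNge ltW//; apply: hdl => //; rewrite subr0 ger0_norm//.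
  apply: le_lt_trans ut _; rewrite /tau -[ltRHS]invrK ltf_pV2 ?posrE ?invr_gt0//.
have nd : {homo D : n m / (n <= m)%N >-> (m <= n)%O}.
  move=> n m nm; apply/subsetPset => w [u /andP[u0 ut] h]; exists u => //.
  by rewrite u0/= (le_trans ut)// lef_pV2 ?posrE// ler_nat.
have PD0 : (P (D 0%N) < +oo)%E by rewrite ltey_eq fin_num_measure.
have cD : (P \o D) m @[m --> \oo] --> P (\bigcap_m D m).
  apply: nonincreasing_cvg_mu => //; exact: bigcapT_measurable.
rewrite D0 measure0 in cD.
have /fine_cvgP[_ /cvgrPdist_lt/(_ _ kappa0)] := cD.
move=> [m _ /(_ m (leqnn m))] /= h; exists (tau m) => //; exists (D m); split => //.
- rewrite -[P _]fineK ?fin_num_measure// lee_fin.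
  by move: h; rewrite sub0r normrN => /ltW; apply: le_trans; exact: ler_norm.
- by move=> w u h1 h2; exists u.
Qed.

End oscillation.

Section pathwise.
Context {R : realType} d {T : measurableType d}.

(** The part [c - 1] of a coefficient close to 1, cut off to be bounded
everywhere: the cut-off is invisible where the integrand is close to 1. *)
Definition cut_sub1 (r : R) (c : R[i]) : R[i] :=
  if Normc.normc (c - 1) <= r then c - 1 else 0.

Lemma normc_cut_sub1 r c : 0 <= r -> Normc.normc (cut_sub1 r c) <= r.
Proof. by move=> r0; rewrite /cut_sub1; case: ifPn => // _; rewrite Normc.normc0. Qed.

Definition csimple_integral (n : nat) (t : nat -> R) (c : nat -> T -> R[i])
    (X : R -> T -> R[i]) (u : R) (w : T) : R[i] :=
  \sum_(i < n) c i w * (X (Num.min u (t i.+1)) w - X (Num.min u (t i)) w).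

Section bound.
Context (n : nat) (t : nat -> R) (c : nat -> T -> R[i]) (Z W A : R -> T -> R[i])
  (w : T) (tau eta L : R).
Hypothesis t0 : t 0 = 0.
Hypothesis tS : forall i, (i < n)%N -> t i <= t i.+1.
Hypotheses (tau0 : 0 < tau) (eta0 : 0 <= eta) (eta8 : 8 * eta <= 1) (L0 : 0 <= L).
Hypothesis Z1 : forall u, 0 <= u <= tau -> Normc.normc (Z u w - 1) <= eta.
Hypothesis HZ : forall u, 0 < u <= tau ->
  Normc.normc (\sum_(i < n) (if t i < u <= t i.+1 then c i w else 0) - (Z u w)^-1)
    <= eta.
Hypothesis ZWA : forall u, 0 <= u <= tau -> Z u w = 1 + W u w - A u w.
Hypotheses (W0 : W 0 w = 0) (A0 : A 0 w = 0).
Hypothesis ReA : forall s u, 0 <= s -> s <= u -> u <= tau ->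
  `|complex.Re (A u w) - complex.Re (A s w)| <= L * (u - s).
Hypothesis ImA : forall s u, 0 <= s -> s <= u -> u <= tau ->
  `|complex.Im (A u w) - complex.Im (A s w)| <= L * (u - s).

Let H u := \sum_(i < n) (if t i < u <= t i.+1 then c i w else 0).

Lemma integrand_near1 u : 0 < u <= tau -> Normc.normc (H u - 1) <= 3 * eta.
Proof.
move=> /[dup] ut /andP[u0 utau].
have h1 := HZ ut.
have z1 : Normc.normc (Z u w - 1) <= eta by apply: Z1; rewrite (ltW u0).
have e2 : eta <= 2^-1 by move: eta0 eta8; lra.
have h2 := normc_inv_sub1 e2 z1.
have := normcD (H u - (Z u w)^-1) ((Z u w)^-1 - 1).
rewrite addrA subrK; rewrite -/(H u) in h1; lra.
Qed.

(** Beyond the last node the integrand vanishes, whereas it has to stay close to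
1 on [[0, tau]]. *)
Lemma mesh_covers : tau <= t n.
Proof.
rewrite leNgt; apply/negP => nt.
have tt : 0 < tau <= tau by rewrite tau0 lexx.
have := integrand_near1 tt; rewrite /H big1 => [|[i ni] _ /=].
  rewrite sub0r normcN Normc.normc1; move: eta0 eta8; lra.
case: ifPn => // /andP[_ h]; exfalso.
have := mesh_le tS (_ : (i.+1 <= n <= n)%N); rewrite ni leqnn => /(_ isT); move: nt h; lra.
Qed.

Lemma integrand_cell u i : (i < n)%N -> t i < u <= t i.+1 -> H u = c i w.
Proof.
move=> ni /[dup] uc /andP[iu ui]; rewrite /H (bigD1 (Ordinal ni))//= uc.
rewrite big1 ?addr0// => -[j jn] /= ji.
have {}ji : j != i by apply: contra ji => /eqP ji; apply/eqP/val_inj.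
case: ifPn => // /andP[h1 h2]; exfalso; move: ji; rewrite neq_ltn => /orP[ji|ij].
  by have := mesh_le tS (_ : (j.+1 <= i <= n)%N); rewrite ji ltnW// => /(_ isT);
    move: h1 h2 iu ui; lra.
by have := mesh_le tS (_ : (i.+1 <= j <= n)%N); rewrite ij ltnW// => /(_ isT);
  move: h1 h2 iu ui; lra.
Qed.

Let k i := cut_sub1 (3 * eta) (c i w).
Let dX (X : R -> T -> R[i]) u i := X (Num.min u (t i.+1)) w - X (Num.min u (t i)) w.

(** A cell that meets [[0, tau]] carries a value of the integrand as its
coefficient, for which the cut-off is inactive; the other cells have a null
increment. *)
Lemma coef_cut u i : (i < n)%N -> 0 <= u <= tau ->
  c i w * dX Z u i = dX Z u i + k i * dX Z u i.
Proof.
move=> ni /andP[u0 ut].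
have [e|ne] := eqVneq (Num.min u (t i.+1)) (Num.min u (t i)).
  by rewrite /dX e subrr !mulr0 addr0.
have iu : t i < u.
  rewrite ltNge; apply: contra ne => ui.
  by rewrite !(min_idPl _)// (le_trans ui)// tS.
have ii : t i < t i.+1.
  by rewrite lt_neqAle tS// andbT; apply: contra ne => /eqP ->.
have uc : t i < Num.min tau (t i.+1) <= t i.+1.
  by rewrite lt_min (lt_le_trans iu ut) ii/= ge_min lexx orbT.
have ti0 : 0 <= t i by rewrite -t0; apply: (mesh_le tS); rewrite leq0n ltnW.
have utau : 0 < Num.min tau (t i.+1) <= tau.
  by rewrite lt_min tau0 (le_lt_trans ti0 ii)/= ge_min lexx.
have := integrand_near1 utau; rewrite (integrand_cell ni uc) => h.
by rewrite /k /cut_sub1 h mulrBl mul1r subrKC.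
Qed.

Lemma mesh_telescope u (X : R -> T -> R[i]) : 0 <= u <= tau ->
  \sum_(i < n) dX X u i = X u w - X 0 w.
Proof.
move=> /andP[u0 ut]; rewrite -(big_mkord xpredT (dX X u)).
rewrite (telescope_sumr (fun i => X (Num.min u (t i)) w))//.
by rewrite t0 (min_idPr u0) (min_idPl (le_trans ut mesh_covers)).
Qed.

Lemma mesh_telescope_time u : 0 <= u <= tau ->
  \sum_(i < n) (Num.min u (t i.+1) - Num.min u (t i)) = u.
Proof.
move=> /andP[u0 ut].
rewrite -(big_mkord xpredT (fun i => Num.min u (t i.+1) - Num.min u (t i))).
rewrite (telescope_sumr (fun i => Num.min u (t i)))//.
by rewrite t0 (min_idPr u0) (min_idPl (le_trans ut mesh_covers)) subr0.
Qed.

(** Write each coefficient as [1 + k] with [k] small. The ones telescope to [Z u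
- Z 0 = W u - A u]; the [k] integrate [W] into two real simple integrals, and
integrate the Lipschitz path [A] into a drift. *)
Lemma csimple_integral_sub_bound u : 0 <= u <= tau ->
  `|complex.Im (csimple_integral n t c Z u w) - complex.Im (W u w)| <=
  `|simple_integral n t (fun i w => complex.Re (cut_sub1 (3 * eta) (c i w)))
      (Im_process W) u w| +
  `|simple_integral n t (fun i w => complex.Im (cut_sub1 (3 * eta) (c i w)))
      (Re_process W) u w| + 2 * L * tau.
Proof.
move=> /[dup] ut /andP[u0 utau].
have mint i : (i <= n)%N -> 0 <= Num.min u (t i) <= tau.
  move=> ni; rewrite le_min u0 ge_min utau/= andbT -t0.
  by apply: (mesh_le tS); rewrite leq0n.
have dZE i : (i < n)%N -> dX Z u i = dX W u i - dX A u i.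
  move=> ni; rewrite /dX !ZWA ?mint// 1?ltnW//; ring.
have E1 : csimple_integral n t c Z u w =
    (W u w - A u w) + \sum_(i < n) k i * dX W u i - \sum_(i < n) k i * dX A u i.
  rewrite /csimple_integral -addrA -sumrB.
  have -> : W u w - A u w = \sum_(i < n) dX Z u i.
    rewrite mesh_telescope// !ZWA ?lexx ?(ltW tau0)// W0 A0; ring.
  rewrite -big_split/=; apply: eq_bigr => -[i ni] _ /=.
  by rewrite -/(dX Z u i) coef_cut// [in k i * _]dZE// mulrBr.
have E2 : complex.Im (\sum_(i < n) k i * dX W u i) =
  simple_integral n t (fun i w => complex.Re (cut_sub1 (3 * eta) (c i w)))
      (Im_process W) u w +
  simple_integral n t (fun i w => complex.Im (cut_sub1 (3 * eta) (c i w)))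
      (Re_process W) u w.
  rewrite Im_sum /simple_integral -big_split/=; apply: eq_bigr => i _.
  by rewrite ImM /dX ReD ImD ReN ImN.
have E3 : `|complex.Im (\sum_(i < n) k i * dX A u i)| <= L * tau.
  rewrite Im_sum; apply: le_trans (ler_norm_sum _ _ _) _.
  apply: (@le_trans _ _ (\sum_(i < n) (L * (Num.min u (t i.+1) - Num.min u (t i))))).
    apply: ler_sum => -[i ni] _ /=.
    have k3 : Normc.normc (k i) <= 3 * eta by apply: normc_cut_sub1; move: eta0; lra.
    have kR := le_trans (Re_le_normc (k i)) k3.
    have kI := le_trans (Im_le_normc (k i)) k3.
    have /andP[m0 _] := mint i (ltnW ni).
    have /andP[_ m1] := mint i.+1 ni.
    have m2 : Num.min u (t i) <= Num.min u (t i.+1).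
      by rewrite le_min ge_min lexx/= ge_min tS// orbT.
    have aR := ReA m0 m2 m1; have aI := ImA m0 m2 m1.
    rewrite ImM /dX ReD ImD ReN ImN; apply: le_trans (ler_normD _ _) _.
    rewrite !normrM.
    set x := L * _ in aR aI *.
    have h1 := ler_pM (normr_ge0 _) (normr_ge0 _) kR aI.
    have h2 := ler_pM (normr_ge0 _) (normr_ge0 _) kI aR.
    apply: le_trans (lerD h1 h2) _.
    have x0 : 0 <= x by rewrite /x mulr_ge0// subr_ge0.
    rewrite -mulrDl; apply: ler_piMl => //; move: eta0 eta8; lra.
  by rewrite -mulr_sumr mesh_telescope_time// ler_wpM2l.
have E4 : `|complex.Im (A u w)| <= L * tau.
  have := ImA (lexx 0) u0 utau; rewrite A0 subr0 subr0 => /le_trans; apply.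
  by rewrite ler_wpM2l.
rewrite E1 !ImD !ImN E2.
set a := simple_integral _ _ _ _ _ _; set b := simple_integral _ _ _ _ _ _.
set x := complex.Im (\sum_(i < n) _) in E3 *; set y := complex.Im (A u w) in E4 *.
have -> : complex.Im (W u w) - y + (a + b) - x - complex.Im (W u w) = a + b - (x + y).
  ring.
apply: le_trans (ler_normB _ _) _.
have := ler_normD a b; have := ler_normD x y; move: E3 E4; lra.
Qed.

End bound.
End pathwise.

Section winding_close.
Context {R : realType} d {T : measurableType d} (P : probability T R).

Definition apart (X Y : R -> T -> R) (tau b : R) : set T :=
  [set w | exists2 u, 0 <= u <= tau & b < `|X u w - Y u w|].

Lemma cvg0_eventually_le (u : nat -> \bar R) (kappa : R) :
  u n @[n --> \oo] --> 0%E -> 0 < kappa ->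
  \forall n \near \oo, (u n <= kappa%:E)%E.
Proof.
move=> /fine_cvgP[fu /cvgrPdist_lt cu] k0; have := cu _ k0 => cuk.
near=> n; have fn : u n \is a fin_num by near: n; exact: fu.
rewrite -(fineK fn) lee_fin; apply: le_trans (ler_norm _) _; apply: ltW.
by rewrite -normrN -sub0r; near: n; exact: cuk.
Unshelve. all: by end_near.
Qed.

Lemma mu_ext_setU_le (A B : set T) (a b : R) :
  (mu_ext P A <= a%:E)%E -> (mu_ext P B <= b%:E)%E ->
  (mu_ext P (A `|` B) <= (a + b)%:E)%E.
Proof.
by move=> Aa Bb; apply: le_trans (outer_measureU2 _ _ _) _; rewrite EFinD leeD.
Qed.

Lemma measurable_cut_sub1 r (f : R[i] -> R) (g : R * R -> R) :
  measurable_fun setT g ->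
  (forall z, f z = g (cpair z)) ->
  measurable_fun setT (fun p : R * R => f (cut_sub1 r (p.1 +i* p.2))).
Proof.
move=> mg fg.
have m1 : measurable_fun setT (fun p : R * R => p.1 - 1).
  by apply: measurable_realfun.measurable_funB => //; exact: measurable_fst.
have m2 : measurable_fun setT (fun p : R * R => p.2 - 0).
  by apply: measurable_realfun.measurable_funB => //; exact: measurable_snd.
rewrite (_ : (fun p => _) = fun p : R * R =>
    if Num.sqrt ((p.1 - 1) ^+ 2 + (p.2 - 0) ^+ 2) <= r
    then g (p.1 - 1, p.2 - 0) else g (0, 0)); last first.
  by apply/funext => -[x y] /=; rewrite /cut_sub1 /=; case: ifPn => _; rewrite fg.
apply: measurable_fun_ifT.
- apply: measurable_fun_ler => //.
  apply: (measurableT_comp (continuous_measurable_fun _)).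
    exact: sqrt_continuous.
  by apply: measurable_realfun.measurable_funD; exact: measurable_realfun.measurable_funX.
- by apply: measurableT_comp => //; exact: measurable_fun_pair.
- exact: measurable_cst.
Qed.

Lemma meas_wrt_cut_sub1 (G : set_system T) r (f : R[i] -> R) (g : R * R -> R)
    (c : T -> R[i]) : measurable_fun setT g -> (forall z, f z = g (cpair z)) ->
  cmeasurable_wrt G c -> meas_wrt G (fun w => f (cut_sub1 r (c w))).
Proof.
move=> mg fg mc; apply/meas_wrtP => A mA; apply: sub_gen_smallest.
have mB := measurable_cut_sub1 r mg fg measurableT mA; rewrite setTI in mB.
have := mc _ mB; congr (G _); apply/seteqP; split => w /=;
  by rewrite /cpair/=; case: (c w).
Qed.

Variables (lambda : R) (W Z : R -> T -> R[i]) (theta : R -> T -> R).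
Hypotheses (lambda0 : 0 <= lambda) (pW : planar_brownian_motion P W)
  (ouZ : ou_process P lambda (1 +i* 0) W Z)
  (wtheta : winding_process P (natural_filtration (fun t w => cpair (W t w))) Z theta).

Let A u w := lambda%:C * path_integral (Z ^~ w) u.

Lemma drift_lipschitz w tau :
  (forall u, 0 <= u <= tau -> Normc.normc (Z u w - 1) <= 1) ->
  forall s u, 0 <= s -> s <= u -> u <= tau ->
  `|complex.Re (A u w) - complex.Re (A s w)| <= 2 * lambda * (u - s) /\
  `|complex.Im (A u w) - complex.Im (A s w)| <= 2 * lambda * (u - s).
Proof.
move=> Z1 s u s0 su ut.
have Z2 v : 0 <= v <= tau -> Normc.normc (Z v w) <= 2.
  move=> /Z1 h; have := normcD (Z v w - 1) 1.
  by rewrite subrK Normc.normc1; lra.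
have ReA v : complex.Re (A v w) =
    lambda * \int[lebesgue_measure]_(r in `[0, v]) complex.Re (Z r w).
  by rewrite /A /path_integral /= mul0r subr0.
have ImA v : complex.Im (A v w) =
    lambda * \int[lebesgue_measure]_(r in `[0, v]) complex.Im (Z r w).
  by rewrite /A /path_integral /= mul0r addr0.
rewrite !ReA !ImA -!mulrBr !normrM (ger0_norm lambda0) [2 * _]mulrC -mulrA.
split; apply: ler_wpM2l => //.
- apply: (Rintegral_path_lipschitz (tau := tau)) => //.
  + exact: ou_continuous_Re ouZ w.
  + by move=> v /Z2; apply: le_trans; exact: Re_le_normc.
- apply: (Rintegral_path_lipschitz (tau := tau)) => //.
  + exact: ou_continuous_Im ouZ w.
  + by move=> v /Z2; apply: le_trans; exact: Im_le_normc.
Qed.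

Lemma drift0 w : A 0 w = 0.
Proof.
by rewrite /A /path_integral set_itv1 !Rintegral_set1; exact: mulr0.
Qed.

Lemma planar_start w : W 0 w = 0.
Proof.
have [bR bI _] := pW; have := bm_start bR w; have := bm_start bI w.
by rewrite /Re_process /Im_process; case: (W 0 w) => a b /= -> ->.
Qed.

Lemma two_step_bound (i v x m1 m2 dr a : R) : `|x - i| <= a ->
  `|x - v| <= `|m1| + `|m2| + dr -> `|m1| <= a -> `|m2| <= a -> dr <= 2 * a ->
  `|i - v| <= 5 * a.
Proof. by have := ler_distD x i v; rewrite [`|i - x|]distrC; lra. Qed.

(** Near time 0 the process [Z] is close to 1, and so are the coefficients of the
simple processes approximating [1/Z]; what they integrate beyond the motion
itself is a martingale of small quadratic variation plus a drift of order
[tau], negligible against [sqrt tau]. *)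
Lemma winding_close (e kappa : R) : 0 < e -> 0 < kappa ->
  exists2 tau0 : R, 0 < tau0 & forall tau, 0 < tau <= tau0 ->
  (mu_ext P (apart theta (Im_process W) tau (e * Num.sqrt tau)) <= kappa%:E)%E.
Proof.
move=> e0 kappa0.
have k8 : 0 < kappa / 8 by rewrite divr_gt0.
have sk : 0 < Num.sqrt kappa by rewrite sqrtr_gt0.
have sk2 : Num.sqrt kappa ^+ 2 = kappa by rewrite sqr_sqrtr// ltW.
(* With coefficients bounded by [3 eta] and the level [a = e sqrt tau / 8], the
   maximal inequality gives [9 eta ^ 2 * 8 tau / a ^ 2], that is
   [4608 eta ^ 2 / e ^ 2], and [192 ^ 2 = 8 * 4608]. *)
pose eta := Num.min 8^-1 (e * Num.sqrt kappa / 192).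
have eta0 : 0 < eta by rewrite lt_min invr_gt0 ltr0n divr_gt0// mulr_gt0.
have eta8 : 8 * eta <= 1.
  have : eta <= 8^-1 by rewrite ge_min lexx.
  by lra.
have eta1 : eta <= 1 by lra.
have etae : eta <= e * Num.sqrt kappa / 192 by rewrite ge_min lexx orbT.
have eta2 : 0 < eta / 2 by rewrite divr_gt0.
have [tau1 tau10 [E1 [mE1 PE1 hE1]]] := small_time_oscillation P
  (ou_measurable_Re ouZ) (ou_continuous_Re ouZ) eta2 k8.
have [tau2 tau20 [E2 [mE2 PE2 hE2]]] := small_time_oscillation P
  (ou_measurable_Im ouZ) (ou_continuous_Im ouZ) eta2 k8.
(* Below [tau3] the drift [4 lambda tau] is at most [e sqrt tau / 4]. *)
pose tau3 := (e / (16 * lambda + 1)) ^+ 2.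
have l1 : 0 < 16 * lambda + 1 by rewrite ltr_wpDl// mulr_ge0.
have tau30 : 0 < tau3 by rewrite exprn_gt0// divr_gt0.
exists (Num.min tau1 (Num.min tau2 tau3)); first by rewrite !lt_min tau10 tau20.
move=> tau /andP[taup]; rewrite !le_min => /and3P[tt1 tt2 tt3].
have st0 : 0 < Num.sqrt tau by rewrite sqrtr_gt0.
have st2 : Num.sqrt tau ^+ 2 = tau by rewrite sqr_sqrtr// ltW.
have drift : 2 * (2 * lambda) * tau <= 2 * (e * Num.sqrt tau / 8).
  have h : Num.sqrt tau <= e / (16 * lambda + 1).
    by rewrite -[leRHS]ger0_norm ?divr_ge0 ?(ltW e0) ?(ltW l1)// -sqrtr_sqr ler_sqrt ?sqr_ge0.
  rewrite ler_pdivlMr// in h.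
  have : 16 * lambda * Num.sqrt tau <= e.
    by apply: le_trans h; rewrite mulrC ler_wpM2l ?ltW// ltrDl.
  move=> h'; rewrite -{1}st2 expr2.
  have := ler_wpM2r (ltW st0) h'; lra.
have [_ _ [I [H_ ucpH ucpI] thI]] := wtheta.
pose a := e * Num.sqrt tau / 8.
have a0 : 0 < a by rewrite divr_gt0// mulr_gt0.
have le5a : 5 * a <= e * Num.sqrt tau by move: a0; rewrite /a; lra.
have cH := cvg0_eventually_le (ucpH tau eta eta0) k8.
have cI := cvg0_eventually_le (ucpI tau a a0) k8.
have [n [Hn In]] : exists n, (mu_ext P [set w | exists2 s, (0 <= s <= tau)%R &
      (eta%:C < `|sp_eval (H_ n) s w - (Z s w)^-1|)%R] <= (kappa / 8)%:E)%E /\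
    (mu_ext P [set w | exists2 s, (0 <= s <= tau)%R &
      (a%:C < `|sp_integral (H_ n) Z s w - I s w|)%R] <= (kappa / 8)%:E)%E.
  have [m _ h] := filterI cH cI.
  by exists m; apply: (h m (leqnn m)).
set B1 := [set w | _] in Hn; set B2 := [set w | _] in In.
pose H := H_ n.
have [bR bI] := planar_brownian_motion_wrt pW.
have t0 := sp_time0 H.
have tS := @sp_time_nondecreasing _ _ _ _ H.
have eta3 : 0 <= 3 * eta by rewrite mulr_ge0// ltW.
have bound : ((3 * eta) ^+ 2 * (8 * tau) / a ^+ 2) <= kappa / 8.
  rewrite ler_pdivrMr ?exprn_gt0// /a.
  have := @lerXn2r _ 2 eta (e * Num.sqrt kappa / 192).
  rewrite !nnegrE (ltW eta0) divr_ge0 ?mulr_ge0 ?(ltW e0) ?(ltW sk)// => /(_ isT isT etae).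
  rewrite !expr_div_n !exprMn sk2 st2 => h.
  have := ler_wpM2r (ltW taup) h; lra.
have [E3 [mE3 PE3 hE3]] : exists E : set T, [/\ measurable E, (P E <= (kappa / 8)%:E)%E &
    forall w s, 0 <= s <= tau -> a < `|simple_integral (sp_size H) (sp_time H)
      (fun i w => complex.Re (cut_sub1 (3 * eta) (sp_coef H i w))) (Im_process W) s w| -> E w].
  have [|i w ni|E [mE PE hE]] := simple_integral_maximal (n := sp_size H)
    (k := fun i w => complex.Re (cut_sub1 (3 * eta) (sp_coef H i w)))
    bI taup a0 eta3 t0 tS.
  - move=> i ni _; apply: (meas_wrt_cut_sub1 _ (g := fst)) => //.
    exact: sp_coef_adapted.
  - exact: le_trans (Re_le_normc _) (normc_cut_sub1 _ eta3).
  - by exists E; split => //; apply: le_trans PE _; rewrite lee_fin.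
have [E4 [mE4 PE4 hE4]] : exists E : set T, [/\ measurable E, (P E <= (kappa / 8)%:E)%E &
    forall w s, 0 <= s <= tau -> a < `|simple_integral (sp_size H) (sp_time H)
      (fun i w => complex.Im (cut_sub1 (3 * eta) (sp_coef H i w))) (Re_process W) s w| -> E w].
  have [|i w ni|E [mE PE hE]] := simple_integral_maximal (n := sp_size H)
    (k := fun i w => complex.Im (cut_sub1 (3 * eta) (sp_coef H i w)))
    bR taup a0 eta3 t0 tS.
  - move=> i ni _; apply: (meas_wrt_cut_sub1 _ (g := snd)) => //.
    exact: sp_coef_adapted.
  - exact: le_trans (Im_le_normc _) (normc_cut_sub1 _ eta3).
  - by exists E; split => //; apply: le_trans PE _; rewrite lee_fin.
have [N1 [mN1 PN1 hN1]] := ou_equation ouZ.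
have [N2 [mN2 PN2 hN2]] := thI.
have ext E : measurable E -> (P E <= (kappa / 8)%:E)%E ->
    (mu_ext P E <= (kappa / 8)%:E)%E.
  by move=> mE; rewrite measurable_mu_extE.
have N0 N : measurable N -> P N = 0%E -> (mu_ext P N <= (kappa / 8)%:E)%E.
  by move=> mN PN; apply: ext => //; rewrite PN lee_fin ltW.
(* Eight exceptional sets share the tolerated probability: two null sets, two
   oscillations, two martingales and the two approximations of the stochastic
   integral. *)
have -> : kappa = kappa / 8 + (kappa / 8 + (kappa / 8 + (kappa / 8 + (kappa / 8 +
  (kappa / 8 + (kappa / 8 + kappa / 8)))))) by field.
apply: (@le_trans _ _ (mu_ext P (N1 `|` (N2 `|` (E1 `|` (E2 `|` (E3 `|` (E4 `|`
  (B1 `|` B2))))))))); last first.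
  do 6 (apply: mu_ext_setU_le; first by first [exact: N0|exact: ext]).
  exact: mu_ext_setU_le.
apply: le_mu_ext => w [u ut]; apply: contraPP => /=.
move=> /not_orP[w1 /not_orP[w2 /not_orP[w3 /not_orP[w4 /not_orP[w5 /not_orP[w6
  /not_orP[w7 w8]]]]]]].
have ouw : forall t, 0 <= t -> Z t w = 1 +i* 0 + W t w - A t w.
  by apply: contrapT => h; apply: w1; exact: hN1.
have thw : forall t, 0 <= t -> theta t w = complex.Im (I t w).
  by apply: contrapT => h; apply: w2; exact: hN2.
have Z0 : Z 0 w = 1 by rewrite ouw// drift0 planar_start subr0; exact: addr0.
have Z1 v : 0 <= v <= tau -> Normc.normc (Z v w - 1) <= eta.
  move=> /andP[v0 vt]; apply: le_trans (normc_le_ReIm _) _.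
  have h1 : `|Re_process Z v w - Re_process Z 0 w| <= eta / 2.
    rewrite leNgt; apply/negP => h; apply: w3; apply: (hE1 w v) => //.
    by rewrite v0 (le_trans vt).
  have h2 : `|Im_process Z v w - Im_process Z 0 w| <= eta / 2.
    rewrite leNgt; apply/negP => h; apply: w4; apply: (hE2 w v) => //.
    by rewrite v0 (le_trans vt).
  rewrite /Re_process /Im_process Z0 in h1 h2.
  by rewrite ReD ImD ReN ImN [leRHS](splitr eta); exact: lerD.
have HZ v : 0 < v <= tau -> Normc.normc (\sum_(i < sp_size H)
    (if sp_time H i < v <= sp_time H i.+1 then sp_coef H i w else 0) - (Z v w)^-1) <= eta.
  move=> /andP[v0 vt]; rewrite leNgt; apply/negP => h; apply: w7; exists v.
    by rewrite (ltW v0).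
  by rewrite /sp_eval gt_eqF// add0r normc_norm ltcR.
have lip := @drift_lipschitz w tau.
have {}lip : forall s u, 0 <= s -> s <= u -> u <= tau ->
  `|complex.Re (A u w) - complex.Re (A s w)| <= 2 * lambda * (u - s) /\
  `|complex.Im (A u w) - complex.Im (A s w)| <= 2 * lambda * (u - s).
  by apply: lip => v /Z1 h; apply: le_trans h eta1.
have L0 : 0 <= 2 * lambda by rewrite mulr_ge0.
have ZWA v : 0 <= v <= tau -> Z v w = 1 + W v w - A v w.
  by move=> /andP[v0 _]; rewrite ouw.
have := csimple_integral_sub_bound t0 tS taup (ltW eta0) eta8 L0 Z1 HZ ZWA
  (planar_start w) (drift0 w) (fun s u h1 h2 h3 => (lip s u h1 h2 h3).1)
  (fun s u h1 h2 h3 => (lip s u h1 h2 h3).2) ut.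
set M1 := simple_integral _ _ _ _ _ _; set M2 := simple_integral _ _ _ _ _ _.
have b1 : `|M1| <= a.
  by rewrite leNgt; apply/negP => h; apply: w5; exact: (hE3 w u).
have b2 : `|M2| <= a.
  by rewrite leNgt; apply/negP => h; apply: w6; exact: (hE4 w u).
have b3 : Normc.normc (sp_integral H Z u w - I u w) <= a.
  rewrite leNgt; apply/negP => h; apply: w8; exists u => //.
  by rewrite normc_norm ltcR.
have b4 := le_trans (Im_le_normc _) b3.
rewrite ImD ImN in b4; have /andP[u0 _] := ut.
set x := complex.Im (sp_integral _ _ _ _) in b4; move=> b5.
have {}b5 : `|x - complex.Im (W u w)| <= `|M1| + `|M2| + 2 * (2 * lambda) * tau.
  exact: b5.
apply/negP; rewrite -leNgt thw// /Im_process.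
apply: le_trans (two_step_bound b4 b5 b1 b2 drift) _.
exact: le5a.
Qed.

End winding_close.

(** * Functionals of continuous paths *)

Section continuous_path_space.
Context {R : realType}.

Definition cpath (x : R -> R) := {within `[0, +oo[, continuous x}.

Definition cvg_loc (x_ : nat -> R -> R) (x : R -> R) :=
  forall N e : R, 0 < e -> \forall n \near \oo,
    forall s : R, 0 <= s <= N -> `|x_ n s - x s| <= e.

Definition path_continuous (f : (R -> R) -> R) :=
  forall x_ x, (forall n, cpath (x_ n)) -> cpath x -> cvg_loc x_ x ->
  f (x_ n) @[n --> \oo] --> f x.

Definition path_bounded (f : (R -> R) -> R) (M : R) :=
  forall x, cpath x -> `|f x| <= M.

Lemma cpathP (x : R -> R) :
  (forall s e : R, 0 <= s -> 0 < e -> exists2 dl : R, 0 < dl &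
    forall u, 0 <= u -> `|u - s| < dl -> `|x u - x s| < e) -> cpath x.
Proof.
move=> h; apply/subspace_continuousP => s; rewrite /= in_itv/= andbT => s0.
apply/cvgrPdist_lt => e e0; have [dl dl0 hdl] := h s e s0 e0.
rewrite near_withinE; near=> u; rewrite /= in_itv/= andbT => u0.
have us : `|u - s| < dl by rewrite distrC; near: u; exact: nbhsx_ballx.
by rewrite distrC; exact: hdl.
Unshelve. all: by end_near. Qed.

Lemma cpathD (x y : R -> R) : cpath x -> cpath y -> cpath (fun s => x s + y s).
Proof. by move=> cx cy s; apply: cvgD; [exact: cx|exact: cy]. Qed.

Lemma cpathB (x y : R -> R) : cpath x -> cpath y -> cpath (fun s => x s - y s).
Proof. by move=> cx cy s; apply: cvgB; [exact: cx|exact: cy]. Qed.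

Lemma cpath_scale (c t : R) (x : R -> R) : 0 < t -> cpath x ->
  cpath (fun s => c * x (s * t)).
Proof.
move=> t0 cx; apply: cpathP => s e s0 e0.
have c1 : 0 < `|c| + 1 by rewrite ltr_wpDl.
have [dl dl0 hdl] := continuous_path_at cx (mulr_ge0 s0 (ltW t0)) (divr_gt0 e0 c1).
exists (dl / t) => [|u u0 us]; first exact: divr_gt0.
rewrite -mulrBr normrM.
have h : `|x (u * t) - x (s * t)| < e / (`|c| + 1).
  apply: hdl; first exact: mulr_ge0 u0 (ltW t0).
  by rewrite -mulrBl normrM (gtr0_norm t0) -ltr_pdivlMr.
apply: (@le_lt_trans _ _ ((`|c|) * (e / (`|c| + 1)))).
  by rewrite ler_wpM2l// ltW.
by rewrite mulrA ltr_pdivrMr// mulrC ltr_pM2l// ltrDl.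
Qed.

Lemma cpath_cadlag (x : R -> R) : cpath x -> cadlag x.
Proof.
move=> cx; split=> s s0.
  apply/cvgrPdist_lt => e e0.
  have [dl dl0 hdl] := continuous_path_at cx s0 e0.
  near=> u; rewrite distrC; have su : s < u by near: u; exact: nbhs_right_gt.
  apply: hdl; first by rewrite (le_trans s0)// ltW.
  rewrite gtr0_norm ?subr_gt0// ltrBlDl.
  by near: u; apply: nbhs_right_lt; rewrite ltrDl.
apply/cvg_ex; exists (x s); apply/cvgrPdist_lt => e e0.
have [dl dl0 hdl] := continuous_path_at cx (ltW s0) e0.
near=> u; rewrite distrC.
have us : u < s by near: u; exact: nbhs_left_lt.
apply: hdl; first by apply: ltW; near: u; exact: nbhs_left_gt.
rewrite distrC gtr0_norm ?subr_gt0// ltrBlDr -ltrBlDl.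
by near: u; apply: nbhs_left_gt; rewrite ltrBlDr ltrDl.
Unshelve. all: by end_near. Qed.

(** Locally uniform convergence is Skorokhod convergence with the identity for
all time changes. *)
Lemma skorokhod_path_continuous f : skorokhod_continuous f -> path_continuous f.
Proof.
move=> cf x_ x cx_ cx xx; apply: cf.
- by move=> n; exact: cpath_cadlag.
- exact: cpath_cadlag.
- exists (fun _ s => s); split => //.
  + by move=> n; split => //; rewrite image_id.
  + by move=> e e0; near=> n => s s0; rewrite subrr normr0 ltW.
Unshelve. all: by end_near. Qed.

Lemma skorokhod_path_bounded f : skorokhod_bounded f ->
  exists M, path_bounded f M.
Proof. by move=> [M fM]; exists M => x /cpath_cadlag; exact: fM. Qed.

Section compact_interval.
Context (x : R -> R).
Hypothesis cx : cpath x.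

Lemma cpath_uniform (N e : R) : 0 < e -> exists2 dl : R, 0 < dl &
  forall s u, 0 <= s <= N -> 0 <= u <= N -> `|u - s| < dl -> `|x u - x s| <= e.
Proof.
move=> e0.
have := (compact_near_coveringP _).1 (@segment_compact R 0 N) R (0^'+)
  (fun dl s => 0 <= s -> forall u, 0 <= u <= N -> `|u - s| < dl -> `|x u - x s| <= e) _.
move=> /(_ _) h.
have {}h : \forall dl \near 0^'+, `[0, N]%classic `<=`
    (fun s => 0 <= s -> forall u, 0 <= u <= N -> `|u - s| < dl -> `|x u - x s| <= e).
  apply: h => s /=; rewrite in_itv/= => /andP[s0 sN].
  have [dl dl0 hdl] := continuous_path_at cx s0 (divr_gt0 e0 (ltr0n _ 2)).
  have dl2 : 0 < dl / 2 by rewrite divr_gt0.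
  near=> v eta => /= v0 u /andP[u0 uN] uv.
  have vs : `|v - s| < dl / 2 by rewrite distrC; near: v; exact: nbhsx_ballx.
  have ed : eta < dl / 2 by near: eta; exact: nbhs_right_lt.
  have h1 : `|x v - x s| < e / 2 by apply: hdl => //; lra.
  have h2 : `|x u - x s| < e / 2.
    by apply: hdl => //; have := ler_distD v u s; lra.
  by have := ler_distD (x s) (x u) (x v); rewrite [`|x s - x v|]distrC; lra.
have [dl dlh dl0] : exists2 dl : R, `[0, N]%classic `<=`
    (fun s => 0 <= s -> forall u, 0 <= u <= N -> `|u - s| < dl -> `|x u - x s| <= e) &
    0 < dl.
  near (0 : R)^'+ => dl; exists dl; first by near: dl.
  by near: dl; exact: nbhs_right_gt.
exists dl => // s u /[dup] sN /andP[s0 _] uN us; exact: dlh.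
Unshelve. all: by end_near. Qed.

Lemma cpath_bounded_itv (N : R) : exists M : R, forall s, 0 <= s <= N -> `|x s| <= M.
Proof.
have [N0|N0] := leP 0 N; last first.
  by exists 0 => s /andP[s0 sN]; have := le_lt_trans (le_trans s0 sN) N0; rewrite ltxx.
have cN : {within `[0, N], continuous (fun s => `|x s|)}.
  have cN : {within `[0, N], continuous x}.
    by apply: continuous_subspaceW cx => s /=; rewrite !in_itv/= => /andP[->].
  by move=> s; apply: cvg_norm; exact: cN.
have [c _ hc] := EVT_max N0 cN.
by exists `|x c| => s sN; apply: hc; rewrite in_itv.
Qed.

End compact_interval.
End continuous_path_space.

Section skeleton.
Context {R : realType}.

(** The starting point of a path, followed by its increments on a mesh of step
[h]. *)
Definition skel (h : R) (x : R -> R) (i : nat) : R :=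
  if i is j.+1 then x (j.+1%:R * h) - x (j%:R * h) else x 0.

Definition ramp (h : R) (i : nat) (s : R) : R :=
  if i is j.+1 then Num.max 0 (Num.min 1 (s / h - j%:R)) else 1.

(** The piecewise linear path with skeleton [v]. *)
Definition polyline (h : R) (n : nat) (v : nat -> R) (s : R) : R :=
  \sum_(i < n) v i * ramp h i s.

Lemma continuous_ramp h i : continuous (ramp h i).
Proof.
case: i => [|i]; first exact: cst_continuous.
rewrite (_ : ramp h i.+1 = cst 0 \max (cst 1 \min (fun s => s / h - i%:R)))//.
move=> s; apply: continuous_max; first exact: cst_continuous.
apply: continuous_min; first exact: cst_continuous.
by apply: cvgB; [apply: cvgMl; exact: cvg_id|exact: cvg_cst].
Qed.

Lemma cpath_polyline h n v : cpath (polyline h n v).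
Proof.
apply: continuous_subspaceT => s.
elim: n => [|n IH].
  by rewrite (_ : polyline h 0 v = cst 0); [exact: cvg_cst|
    apply/funext => u; rewrite /polyline big_ord0].
rewrite (_ : polyline h n.+1 v = fun s => polyline h n v s + v n * ramp h n s).
  by apply: cvgD => //; apply: cvgMr; exact: continuous_ramp.
by apply/funext => u; rewrite /polyline big_ord_recr.
Qed.

Lemma skel_sum h x j : \sum_(i < j.+1) skel h x i = x (j%:R * h).
Proof.
elim: j => [|j IH]; first by rewrite big_ord1 /= mul0r.
by rewrite big_ord_recr IH /= subrKC.
Qed.

Lemma polylineE h n v j s : 0 < h -> (j.+1 < n)%N -> j%:R <= s / h < j.+1%:R ->
  polyline h n v s =
  \sum_(i < j.+1) v i + v j.+1 * (s / h - j%:R).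
Proof.
move=> h0 jn /andP[js sj].
have h1 i : (i <= j)%N -> ramp h i s = 1.
  case: i => // i ij /=; rewrite (min_idPl _).
    by rewrite (max_idPr _).
  rewrite lerBrDr addrC natr1; apply: le_trans js; by rewrite ler_nat.
have h2 : ramp h j.+1 s = s / h - j%:R.
  rewrite /= (min_idPr _); last by move: sj; rewrite -natr1; lra.
  by rewrite (max_idPr _)// subr_ge0.
have h3 i : (j.+1 < i)%N -> ramp h i s = 0.
  case: i => // i ij /=; apply/max_idPl; rewrite ge_min; apply/orP; right.
  rewrite subr_le0; apply: ltW; apply: lt_le_trans sj _; by rewrite ler_nat.
rewrite /polyline -(big_mkord xpredT (fun i => v i * ramp h i s)).
rewrite (big_cat_nat (n := j.+1))//=; last exact: ltnW.
rewrite [X in _ + X]big_ltn// h2; congr (_ + _).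
  rewrite big_mkord; apply: eq_bigr => -[i ij] _ /=.
  by rewrite h1 ?mulr1.
rewrite big_nat_cond big1 ?addr0// => i /andP[/andP[ij _] _].
by rewrite h3// mulr0.
Qed.

End skeleton.

Section quantize.
Context {R : realType} (m : nat).
Local Notation k := (m.+1%:R : R).

(** Half-open cells of length [k ^- 3] cover [[- k, k[]; the last cell is the
complement. Finitely many cells make the quantised skeleton a simple function. *)
Definition cells : nat := (2 * m.+1 ^ 4)%N.

Definition cell (x : R) : nat :=
  if (- k <= x) && (x < k) then Num.trunc ((x + k) * k ^+ 3) else cells.

Definition cell_value (l : nat) : R :=
  if (l < cells)%N then l%:R / k ^+ 3 - k else 0.

Lemma k3_gt0 : 0 < k ^+ 3. Proof. by rewrite exprn_gt0. Qed.

Lemma cell_itv x l : (l < cells)%N ->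
  (cell x == l) = (l%:R / k ^+ 3 - k <= x < l.+1%:R / k ^+ 3 - k).
Proof.
move=> lc; have k3 := k3_gt0.
have l1 : l.+1%:R <= cells%:R :> R by rewrite ler_nat.
have cE : cells%:R = 2 * k * k ^+ 3 :> R.
  by rewrite /cells natrM natrX -mulrA -exprS.
rewrite lerBlDr ltrBrDr ler_pdivrMr// ltr_pdivlMr//.
rewrite /cell; case: ifPn => [/andP[xk kx]|].
  have x0 : 0 <= (x + k) * k ^+ 3 by rewrite mulr_ge0 ?(ltW k3)//; lra.
  apply/eqP/idP => [<-|/andP[h1 h2]]; first exact: truncn_itv.
  by apply: truncn_def; rewrite h1 h2.
move=> h; rewrite gtn_eqF//; apply/esym/negbTE; apply: contra h => /andP[h1 h2].
have h3 : 0 <= (x + k) * k ^+ 3 by apply: le_trans h1.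
rewrite pmulr_lge0// in h3.
have h4 : (x + k) * k ^+ 3 < 2 * k * k ^+ 3 by rewrite -cE (lt_le_trans h2).
rewrite ltr_pM2r// in h4; apply/andP; split; lra.
Qed.

Lemma cell_le x : (cell x <= cells)%N.
Proof.
rewrite /cell; case: ifPn => // /andP[xk kx].
have k3 := k3_gt0.
have x0 : 0 <= (x + k) * k ^+ 3 by rewrite mulr_ge0 ?(ltW k3)//; lra.
have /andP[h _] := truncn_itv x0.
rewrite -(ler_nat R); apply: le_trans h _.
have -> : cells%:R = 2 * k * k ^+ 3 :> R.
  by rewrite /cells natrM natrX -mulrA -exprS.
by rewrite ler_pM2r//; lra.
Qed.

Lemma measurable_cell l : measurable [set x | cell x = l].
Proof.
have itvE l' : (l' < cells)%N -> [set x | cell x = l'] =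
    `[l'%:R / k ^+ 3 - k, l'.+1%:R / k ^+ 3 - k[%classic.
  move=> lc; apply/seteqP; split => x /=; rewrite in_itv/= -cell_itv//; by move/eqP.
have [lc|lc|->] := ltngtP l cells; first by rewrite itvE//; exact: measurable_itv.
  rewrite (_ : [set _ | _] = set0)// -subset0 => x /= h.
  by have := cell_le x; rewrite h leqNgt lc.
rewrite (_ : [set _ | _] = ~` \bigcup_(l in [set l | (l < cells)%N]) [set x | cell x = l]).
  apply: measurableC; apply: bigcup_measurable => l' /= lc.
  by rewrite itvE//; exact: measurable_itv.
apply/seteqP; split => x /=.
  by move=> h [l' /= lc]; rewrite h => e; rewrite e ltnn in lc.
move=> h; apply/eqP; rewrite eqn_leq cell_le leqNgt; apply/negP => lc.
by apply: h; exists (cell x).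
Qed.

Lemma cell_valueP (x : R) : `|x| < k -> `|cell_value (cell x) - x| <= (k ^+ 3)^-1.
Proof.
rewrite ltr_norml => /andP[kx xk]; have k3 := k3_gt0.
have x0 : 0 <= (x + k) * k ^+ 3 by rewrite mulr_ge0 ?(ltW k3)//; lra.
have lc : (cell x < cells)%N.
  rewrite /cell (ltW kx) xk -(ltr_nat R).
  have /andP[h _] := truncn_itv x0; apply: le_lt_trans h _.
  have -> : cells%:R = 2 * k * k ^+ 3 :> R.
    by rewrite /cells natrM natrX -mulrA -exprS.
  by rewrite ltr_pM2r//; lra.
have := eqxx (cell x); rewrite {1}cell_itv// /cell_value lc => /andP[h1 h2].
rewrite -[(cell x).+1%:R]natr1 mulrDl mul1r in h2.
set q := (k ^+ 3)^-1 in h1 h2 *; set y := _ * q in h1 h2 *.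
by rewrite ler_norml; apply/andP; split; lra.
Qed.

(** Beyond the starting point, [k ^ 2] steps of length [1 / k] reach the time [k
= m + 1]. *)
Definition approx_size : nat := (m.+1 * m.+1).+1.

Definition approx (x : R -> R) : R -> R :=
  polyline k^-1 approx_size (fun i => cell_value (cell (skel k^-1 x i))).

End quantize.

Section approximation.
Context {R : realType}.

(** At most [k ^ 2] quantisation errors of size [k ^- 3] add up to [1 / k]; what
is left is the modulus of continuity of [x] at step [1 / k]. *)
Lemma approx_cvg (x : R -> R) : cpath x -> cvg_loc (fun m => approx m x) x.
Proof.
move=> cx N e e0.
pose N1 := Num.max 0 N + 1.
have N00 : 0 <= Num.max 0 N by rewrite le_max lexx.
have [M hM] := cpath_bounded_itv cx N1.
have M0 : 0 <= M by apply: le_trans (hM 0 _); rewrite ?lexx //= /N1; lra.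
have [dl dl0 hdl] := cpath_uniform cx N1 (divr_gt0 e0 (ltr0n _ 8)).
have ev (c : R) : \forall m \near \oo, c < m.+1%:R.
  near=> m; apply: (@lt_trans _ _ m%:R); last by rewrite ltr_nat.
  by near: m; exact: nbhs_infty_gtr.
near=> m.
have c1 : N1 < m.+1%:R by near: m; exact: ev.
have c2 : 2 * M < m.+1%:R by near: m; exact: ev.
have c3 : dl^-1 < m.+1%:R by near: m; exact: ev.
have c4 : 4 / e < m.+1%:R by near: m; exact: ev.
set k : R := m.+1%:R in c1 c2 c3 c4 *; move=> s /andP[s0 sN].
have k0 : 0 < k by [].
have k1 : 1 <= k by rewrite ler1n.
have kdl : k^-1 < dl by rewrite -[ltRHS]invrK ltf_pV2 ?posrE ?invr_gt0.
have ke : 4 / k < e by rewrite ltr_pdivrMr// mulrC -ltr_pdivrMr.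
have sk0 : 0 <= s * k := mulr_ge0 s0 (ltW k0).
pose j := Num.trunc (s * k).
have /andP[js sj] : j%:R <= s * k < j.+1%:R by exact: truncn_itv.
have sN0 : s <= Num.max 0 N by rewrite le_max sN orbT.
have jk : (j < m.+1 * m.+1)%N.
  rewrite -(ltr_nat R) natrM -/k; apply: le_lt_trans js _.
  by rewrite ltr_pM2r//; move: c1; rewrite /N1; lra.
have h0 : 0 < k^-1 by rewrite invr_gt0.
have ki : k^-1 <= 1 by rewrite invf_le1.
have jsh : j%:R <= s / k^-1 < j.+1%:R by rewrite invrK js.
pose v (i : nat) : R := cell_value m (cell m (skel k^-1 x i)).
have -> : approx m x s = \sum_(i < j.+1) v i + v j.+1 * (s / k^-1 - j%:R).
  by rewrite /approx (polylineE _ h0 (_ : (j.+1 < approx_size m)%N) jsh).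
have tl i : (i <= j.+1)%N -> 0 <= i%:R * k^-1 <= N1.
  move=> ij; rewrite (mulr_ge0 (ler0n _ _) (ltW h0))/= ler_pdivrMr//.
  apply: (@le_trans _ _ j.+1%:R); first by rewrite ler_nat.
  by move: js sN0; rewrite -natr1 /N1; nra.
have skb i : (i <= j.+1)%N -> `|skel k^-1 x i| < k.
  move=> ij; apply: le_lt_trans c2; case: i ij => [|i] ij /=.
    by have := hM 0 _; rewrite lexx /N1 => /(_ ltac:(lra)); lra.
  have h1 := hM _ (tl i.+1 ij); have h2 := hM _ (tl i (ltnW ij)).
  by apply: le_trans (ler_normB _ _) _; lra.
have vb i : (i <= j.+1)%N -> `|v i - skel k^-1 x i| <= (k ^+ 3)^-1.
  by move=> /skb; exact: cell_valueP.
have ljs : `|j%:R * k^-1 - s| < dl.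
  apply: le_lt_trans kdl; rewrite distrC ger0_norm; last by rewrite subr_ge0 ler_pdivrMr.
  by rewrite -[X in X - _](mulfK (lt0r_neq0 k0)) -mulrBl; apply: ler_piMl;
    [exact: ltW|move: sj]; rewrite -natr1; lra.
have sN1 : 0 <= s <= N1 by rewrite s0 /N1; lra.
have osc1 := hdl _ _ sN1 (tl j (leqnSn j)) ljs.
have osc2 : `|skel k^-1 x j.+1| <= e / 8.
  apply: hdl; [exact: tl|exact: tl|].
  by rewrite -mulrBl -natr1 addrAC subrr add0r mul1r gtr0_norm.
have sum : `|\sum_(i < j.+1) v i - x (j%:R * k^-1)| <= k^-1.
  rewrite -skel_sum -sumrB; apply: le_trans (ler_norm_sum _ _ _) _.
  apply: (@le_trans _ _ (\sum_(i < j.+1) (k ^+ 3)^-1)).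
    by apply: ler_sum => -[i ij] _ /=; apply: vb; exact: ltnW.
  rewrite sumr_const card_ord -mulr_natl ler_pdivrMr ?exprn_gt0//.
  rewrite exprS mulrA mulVf ?gt_eqF// mul1r expr2 -natrM ler_nat//.
have k3 : (k ^+ 3)^-1 <= k^-1.
  rewrite lef_pV2 ?posrE ?exprn_gt0// exprS; apply: ler_peMr; first exact: ltW.
  by rewrite expr2; nra.
have vj := vb j.+1 (leqnn _).
have r1 : `|s / k^-1 - j%:R| <= 1.
  by rewrite invrK ger0_norm ?subr_ge0//; move: sj; rewrite -natr1; lra.
have vr : `|v j.+1 * (s / k^-1 - j%:R)| <= `|v j.+1|.
  by rewrite normrM ler_piMr.
have vjb : `|v j.+1| <= e / 8 + k^-1.
  have := ler_normD (v j.+1 - skel k^-1 x j.+1) (skel k^-1 x j.+1).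
  rewrite subrK => h; apply: le_trans h _; rewrite addrC; apply: lerD => //.
  exact: le_trans vj k3.
set S := \sum_(i < j.+1) v i in sum *; set V := v j.+1 * _ in vr *.
set y := x (j%:R * k^-1) in sum osc1.
have -> : S + V - x s = (S - y) + V + (y - x s) by ring.
apply: le_trans (ler_normD _ _) _.
have q4 : k^-1 < e / 4 by rewrite ltr_pdivlMr// mulrC.
have h1 := lerD (lerD sum (le_trans vr vjb)) osc1.
apply: le_trans (lerD (ler_normD _ _) (lexx _)) _; apply: le_trans h1 _.
by move: (k^-1) q4 => q q4; lra.
Unshelve. all: by end_near. Qed.

Lemma cpath_approx m (x : R -> R) : cpath (approx m x).
Proof. exact: cpath_polyline. Qed.

End approximation.

(** * Laws of functionals of a continuous process *)

Section simple_functions.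
Context {R : realType} d {T : measurableType d} (P : probability T R).

Lemma bounded_integrable (g : T -> R) (M : R) : measurable_fun setT g ->
  (forall w, `|g w| <= M) -> P.-integrable setT (EFin \o g).
Proof.
move=> mg gM; apply: (le_integrable measurableT (g := EFin \o cst M)).
- exact/measurable_EFinP.
- by move=> w _; rewrite /= lee_fin (le_trans (gM w))// ler_norm.
- exact: finite_measure_integrable_cst.
Qed.

Lemma bounded_cvg_integral (g_ : nat -> T -> R) (g : T -> R) (M : R) :
  (forall n, measurable_fun setT (g_ n)) ->
  (forall w, g_ n w @[n --> \oo] --> g w) -> (forall n w, `|g_ n w| <= M) ->
  (\int[P]_w (g_ n w)%:E)%E @[n --> \oo] --> (\int[P]_w (g w)%:E)%E.
Proof.
move=> mg cg gM.
apply: (@dominated_cvg _ _ _ P setT measurableT (fun n w => (g_ n w)%:E)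
  (fun w => (g w)%:E) (EFin \o cst M)).
- by move=> n; exact/measurable_EFinP.
- by move=> w _; apply: cvg_EFin; [exact: nearW|exact: cg].
- by [].
- exact: finite_measure_integrable_cst.
- by move=> n w _; rewrite /= lee_fin.
Qed.

Lemma measurable_simple (I : finType) (F : I -> R) (A : I -> set T) :
  (forall i, measurable (A i)) ->
  measurable_fun setT (fun w => \sum_(i : I) F i * \1_(A i) w).
Proof.
move=> mA; apply: (@measurable_sum _ _ _ _ I (index_enum I)
  (fun i w => F i * \1_(A i) w)) => i.
by apply: measurable_realfun.measurable_funM => //; exact: measurable_indic.
Qed.

Lemma integral_simple (I : finType) (F : I -> R) (A : I -> set T) :
  (forall i, measurable (A i)) ->
  (\int[P]_w (\sum_(i : I) F i * \1_(A i) w)%:E = \sum_(i : I) (F i)%:E * P (A i))%E.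
Proof.
move=> mA.
under eq_integral do rewrite -sumEFin.
have iA i : P.-integrable setT (fun w => (\1_(A i) w)%:E) by exact: integrable_indic.
rewrite (@integral_sum _ _ _ _ _ measurableT I (fun i w => (F i * \1_(A i) w)%:E)).
  apply: eq_bigr => i _.
  under eq_integral do rewrite EFinM.
  by rewrite integralZl// integral_indic// setIT.
move=> i; rewrite (_ : (fun w => _) = (fun w => (F i)%:E * (\1_(A i) w)%:E)%E).
  exact: integrableZl.
by apply/funext => w; rewrite EFinM.
Qed.

End simple_functions.

Section boxes.
Context {R : realType} d {T : measurableType d}.

Definition box (X : R -> T -> R) (h : R) (n : nat) (A : nat -> set R) : set T :=
  [set w | forall i, (i < n)%N -> A i (skel h (X ^~ w) i)].

Lemma measurable_skel (X : R -> T -> R) h i :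
  (forall t, 0 <= t -> measurable_fun setT (X t)) -> 0 <= h ->
  measurable_fun setT (fun w => skel h (X ^~ w) i).
Proof.
move=> mX h0; case: i => [|i]; first exact: mX.
by apply: measurable_realfun.measurable_funB; apply: mX; exact: mulr_ge0 (ler0n _ _) h0.
Qed.

Lemma boxS X h n A :
  box X h n.+1 A = box X h n A `&` (fun w => skel h (X ^~ w) n) @^-1` A n.
Proof.
apply/seteqP; split => w /=.
  by move=> h1; split => [i ni|]; apply: h1 => //; exact: ltnW.
by move=> [h1 h2] i; rewrite ltnS leq_eqVlt => /predU1P[->//|]; exact: h1.
Qed.

Lemma measurable_box X h n A : (forall t, 0 <= t -> measurable_fun setT (X t)) ->
  0 <= h -> (forall i, measurable (A i)) -> measurable (box X h n A).
Proof.
move=> mX h0 mA; elim: n => [|n IH].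
  by rewrite (_ : box _ _ _ _ = setT)//; apply/seteqP; split.
rewrite boxS; apply: measurableI => //; rewrite -[X in measurable X]setTI.
exact: (measurable_skel n mX h0).
Qed.

End boxes.

Section functionals.
Context {R : realType}.
Variables (f : (R -> R) -> R) (M : R).
Hypotheses (fc : path_continuous f) (fM : path_bounded f M).

Definition cells_path m (l : seq nat) : R -> R :=
  polyline m.+1%:R^-1 (approx_size m) (fun i => cell_value m (nth 0%N l i)).

Definition in_cells m (l : seq nat) (i : nat) : set R :=
  [set v | cell m v = nth 0%N l i].

Definition ord_seq m (k : (approx_size m).-tuple 'I_(cells m).+1) : seq nat :=
  [seq val i | i <- k].

Lemma nth_ord_seq m (k : (approx_size m).-tuple 'I_(cells m).+1) (i : 'I_(approx_size m)) :
  nth 0%N (ord_seq k) i = tnth k i.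
Proof. by rewrite (nth_map (tnth k i)) ?size_tuple// -tnth_nth. Qed.

Lemma approx_cells_path m (x : R -> R) l :
  (forall i, (i < approx_size m)%N -> in_cells m l i (skel m.+1%:R^-1 x i)) ->
  approx m x = cells_path m l.
Proof.
move=> h; apply/funext => s; rewrite /approx /cells_path /polyline.
by apply: eq_bigr => -[i ik] _; rewrite /= h.
Qed.

Section one_process.
Context d {T : measurableType d} (P : probability T R) (X : R -> T -> R).
Hypothesis mX : forall t, 0 <= t -> measurable_fun setT (X t).
Hypothesis cX : continuous_paths X.

Lemma approx_simple m w : f (approx m (X ^~ w)) =
  \sum_(k : (approx_size m).-tuple 'I_(cells m).+1)
    f (cells_path m (ord_seq k)) *
    \1_(box X m.+1%:R^-1 (approx_size m) (in_cells m (ord_seq k))) w.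
Proof.
pose k0 : (approx_size m).-tuple 'I_(cells m).+1 :=
  [tuple inord (cell m (skel m.+1%:R^-1 (X ^~ w) i)) | i < approx_size m].
have in_k0 : forall i, (i < approx_size m)%N ->
    in_cells m (ord_seq k0) i (skel m.+1%:R^-1 (X ^~ w) i).
  move=> i ik; rewrite /in_cells /= (nth_ord_seq k0 (Ordinal ik)) tnth_mktuple /=.
  by rewrite inordK// ltnS cell_le.
rewrite (bigD1 k0)//= big1 ?addr0.
  rewrite indicE mem_set ?mulr1; first by rewrite -(approx_cells_path in_k0).
  exact: in_k0.
move=> k kk0; rewrite indicE memNset ?mulr0// => in_k.
case/eqP: kk0; apply: eq_from_tnth => i; apply/val_inj.
by rewrite /= -!nth_ord_seq -(in_k i (ltn_ord i)) -(in_k0 i (ltn_ord i)).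
Qed.

Lemma measurable_in_cells m l i : measurable (in_cells m l i).
Proof. exact: measurable_cell. Qed.

Lemma measurable_functional_approx m :
  measurable_fun setT (fun w => f (approx m (X ^~ w))).
Proof.
rewrite (_ : (fun w => _) = fun w => \sum_(k : (approx_size m).-tuple 'I_(cells m).+1)
    f (cells_path m (ord_seq k)) *
    \1_(box X m.+1%:R^-1 (approx_size m) (in_cells m (ord_seq k))) w).
  apply: measurable_simple => k; apply: measurable_box => // i.
  exact: measurable_in_cells.
by apply/funext => w; exact: approx_simple.
Qed.

Lemma functional_approx_cvg w :
  f (approx m (X ^~ w)) @[m --> \oo] --> f (X ^~ w).
Proof.
by apply: fc => [m||]; [exact: cpath_approx|exact: cX|apply: approx_cvg; exact: cX].
Qed.

Lemma measurable_functional : measurable_fun setT (fun w => f (X ^~ w)).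
Proof.
apply: (measurable_fun_cvg measurable_functional_approx) => w _.
exact: functional_approx_cvg.
Qed.

Lemma integrable_functional : P.-integrable setT (fun w => (f (X ^~ w))%:E).
Proof.
by apply: (bounded_integrable P measurable_functional) => w; apply: fM; exact: cX.
Qed.

End one_process.

Definition same_boxes d {T : measurableType d} (P : probability T R) (X : R -> T -> R)
    d' {T' : measurableType d'} (Q : probability T' R) (Y : R -> T' -> R) :=
  forall h n A, 0 < h -> (forall i, measurable (A i)) ->
  P (box X h n A) = Q (box Y h n A).

(** The value of [f] at a quantised path is a simple function of the cells that
contain the skeleton, so its expectation only involves box probabilities;
quantised paths converge. *)
Lemma same_boxes_integral d (T : measurableType d) (P : probability T R)
    (X : R -> T -> R) d' (T' : measurableType d') (Q : probability T' R)
    (Y : R -> T' -> R) :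
  (forall t, 0 <= t -> measurable_fun setT (X t)) -> continuous_paths X ->
  (forall t, 0 <= t -> measurable_fun setT (Y t)) -> continuous_paths Y ->
  same_boxes P X Q Y ->
  (\int[P]_w (f (X ^~ w))%:E = \int[Q]_w (f (Y ^~ w))%:E)%E.
Proof.
move=> mX cX mY cY XY.
have aE m : (\int[P]_w (f (approx m (X ^~ w)))%:E =
             \int[Q]_w (f (approx m (Y ^~ w)))%:E)%E.
  under eq_integral do rewrite approx_simple.
  under [RHS]eq_integral do rewrite approx_simple.
  have m0 : 0 < m.+1%:R^-1 :> R by rewrite invr_gt0.
  rewrite !integral_simple; last 2 first.
  - move=> k; apply: measurable_box => // i; exact: measurable_in_cells.
  - move=> k; apply: measurable_box => // i; exact: measurable_in_cells.
  apply: eq_bigr => k _; rewrite XY// => i; exact: measurable_in_cells.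
have cvgX : (\int[P]_w (f (approx m (X ^~ w)))%:E)%E @[m --> \oo] -->
    (\int[P]_w (f (X ^~ w))%:E)%E.
  apply: (bounded_cvg_integral (M := M)) => [m|w|m w].
  - exact: measurable_functional_approx.
  - exact: functional_approx_cvg.
  - by apply: fM; exact: cpath_approx.
have cvgY : (\int[Q]_w (f (approx m (Y ^~ w)))%:E)%E @[m --> \oo] -->
    (\int[Q]_w (f (Y ^~ w))%:E)%E.
  apply: (bounded_cvg_integral (M := M)) => [m|w|m w].
  - exact: measurable_functional_approx.
  - exact: functional_approx_cvg.
  - by apply: fM; exact: cpath_approx.
apply: (cvg_unique (@ereal_hausdorff R) cvgX).
rewrite (_ : (fun m => _) = (fun m => \int[Q]_w (f (approx m (Y ^~ w)))%:E)%E)//.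
by apply/funext => m.
Qed.

End functionals.

Lemma cvg_maxr (R : realType) (a_ b_ : nat -> R) (a b : R) :
  a_ n @[n --> \oo] --> a -> b_ n @[n --> \oo] --> b ->
  Num.max (a_ n) (b_ n) @[n --> \oo] --> Num.max a b.
Proof.
move=> /cvgrPdist_le ca /cvgrPdist_le cb; apply/cvgrPdist_le => e e0.
have {}ca := ca e e0; have {}cb := cb e e0.
near=> n.
have : `|a - a_ n| <= e by near: n; exact: ca.
have : `|b - b_ n| <= e by near: n; exact: cb.
rewrite !ler_norml => /andP[h1 h2] /andP[h3 h4].
by case: (leP a b) => h; case: (leP (a_ n) (b_ n)) => h'; apply/andP; split; lra.
Unshelve. all: by end_near. Qed.

Section modulus.
Context {R : realType}.
Variables (f : (R -> R) -> R) (M : R).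
Hypotheses (fc : path_continuous f) (fM : path_bounded f M).

(** Integer codes enumerate all the possible values of [approx], hence a
countable family that is dense for locally uniform convergence. *)
Definition dense_path (k : nat) : R -> R :=
  if unpickle k is Some (m, l) then cells_path m l else cst 0.

Lemma cpath_dense_path k : cpath (dense_path k).
Proof.
rewrite /dense_path; case: unpickle => [[m l]|]; first exact: cpath_polyline.
by apply: continuous_subspaceT => s; exact: cst_continuous.
Qed.

Lemma approx_dense_path m (x : R -> R) : exists k, dense_path k = approx m x.
Proof.
pose l := mkseq (fun i => cell m (skel m.+1%:R^-1 x i)) (approx_size m).
exists (pickle (m, l)); rewrite /dense_path pickleK; apply/esym.
by apply: approx_cells_path => i ik; rewrite /in_cells/= nth_mkseq.
Qed.

Definition small (dl : R) (z : R -> R) := forall s, 0 <= s <= dl^-1 -> `|z s| <= dl.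

Definition gap (y z : R -> R) : R := `|f (fun s => y s + z s) - f y|.

Fixpoint modulus_upto (dl : R) (n : nat) (y : R -> R) : R :=
  if n is k.+1 then
    Num.max (modulus_upto dl k y)
      (if `[< small dl (dense_path k) >] then gap y (dense_path k) else 0)
  else 0.

(** The oscillation of [f] over the paths that are close to [y]. Only countably
many perturbations enter, which makes it a measurable functional. *)
Definition modulus (dl : R) (y : R -> R) : R :=
  sup (range (fun n => modulus_upto dl n y)).

Lemma gap_le y z : cpath y -> cpath z -> gap y z <= 2 * M.
Proof.
move=> cy cz; apply: le_trans (ler_normB _ _) _.
by have := fM cy; have := fM (cpathD cy cz); lra.
Qed.

Lemma M_ge0 : 0 <= M.
Proof. exact: le_trans (normr_ge0 _) (fM (@cpath_dense_path 0%N)). Qed.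

Lemma modulus_upto_bound dl n y : cpath y -> 0 <= modulus_upto dl n y <= 2 * M.
Proof.
move=> cy; have M0 := M_ge0; elim: n => [|n /andP[h1 h2]] /=.
  by rewrite lexx/= mulr_ge0.
rewrite le_max h1/= ge_max h2/=.
by case: ifPn => _; [apply: gap_le => //; exact: cpath_dense_path|exact: mulr_ge0].
Qed.

Lemma modulus_upto_homo dl y :
  {homo (fun n => modulus_upto dl n y) : n m / (n <= m)%N >-> n <= m}.
Proof.
by apply: homo_leq => [//|? ? ?|n]; [exact: le_trans|rewrite /= le_max lexx].
Qed.

Lemma modulus_upto_cvg dl y : cpath y ->
  modulus_upto dl n y @[n --> \oo] --> modulus dl y.
Proof.
move=> cy; apply: nondecreasing_cvgn; first exact: modulus_upto_homo.
by exists (2 * M) => _ [n _ <-]; have /andP[] := modulus_upto_bound dl n cy.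
Qed.

Lemma modulus_upto_le dl n y : cpath y -> modulus_upto dl n y <= modulus dl y.
Proof.
move=> cy; apply: ub_le_sup; last by exists n.
by exists (2 * M) => _ [k _ <-]; have /andP[] := modulus_upto_bound dl k cy.
Qed.

Lemma modulus_bound dl y : cpath y -> 0 <= modulus dl y <= 2 * M.
Proof.
move=> cy; apply/andP; split; first exact: (modulus_upto_le dl 0 cy).
apply: ge_sup; first by exists (modulus_upto dl 0 y), 0%N.
by move=> _ [k _ <-]; have /andP[] := modulus_upto_bound dl k cy.
Qed.

Lemma dense_gap_le dl k y : cpath y -> small dl (dense_path k) ->
  gap y (dense_path k) <= modulus dl y.
Proof.
move=> cy sk; apply: le_trans (modulus_upto_le dl k.+1 cy).
by rewrite /= asboolT// le_max lexx orbT.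
Qed.

Lemma cvg_loc_addl (y : R -> R) z_ z : cvg_loc z_ z ->
  cvg_loc (fun n s => y s + z_ n s) (fun s => y s + z s).
Proof.
move=> zz N e e0; have := zz N e e0; apply: filterS => n h s /h.
by rewrite opprD addrACA subrr add0r.
Qed.

(** The difference [x - y] is a limit of paths of the dense family, which are
eventually of size at most [dl]. *)
Lemma modulusP dl x y : 0 < dl -> cpath x -> cpath y ->
  small (dl / 2) (fun s => x s - y s) -> `|f x - f y| <= modulus dl y.
Proof.
move=> dl0 cx cy xy.
pose z s := x s - y s; have cz : cpath z by exact: cpathB.
have zc := approx_cvg cz.
have fz : gap y (approx m z) @[m --> \oo] --> `|f x - f y|.
  apply: cvg_norm; apply: cvgB; last exact: cvg_cst.
  have -> : f x = f (fun s => y s + z s).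
    by congr f; apply/funext => s; rewrite /z addrC subrK.
  apply: fc; [|exact: cpathD|exact: cvg_loc_addl].
  by move=> m; apply: cpathD => //; exact: cpath_approx.
apply: (@closed_cvg _ _ \oo _ (fun m => gap y (approx m z)) (fun v => v <= modulus dl y)).
- exact: closed_le.
- have := zc dl^-1 (dl / 2) (divr_gt0 dl0 (ltr0n _ 2)).
  apply: filterS => m hm; have [k hk] := approx_dense_path m z.
  rewrite -hk; apply: dense_gap_le => // s ss; rewrite hk.
  have h1 := hm s ss; have h2 : `|z s| <= dl / 2.
    apply: xy; have /andP[-> h] := ss; apply: le_trans h _.
    by rewrite lef_pV2 ?posrE ?divr_gt0//; lra.
  have := ler_normD (approx m z s - z s) (z s); rewrite subrK; lra.
- exact: fz.
Qed.

(** A path [z] of size at most [1 / (j + 1)] realises half of the oscillation;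
these paths tend to 0, and the continuity of [f] makes their gaps tend to 0. *)
Lemma modulus_cvg0 y : cpath y -> modulus j.+1%:R^-1 y @[j --> \oo] --> 0.
Proof.
move=> cy.
have ex_z j : exists z, [/\ cpath z, small j.+1%:R^-1 z &
    modulus j.+1%:R^-1 y <= 2 * gap y z].
  set dl : R := j.+1%:R^-1.
  have dl0 : 0 < dl by rewrite invr_gt0.
  have /andP[m0 _] := modulus_bound dl cy.
  have [m1|m1] := leP (modulus dl y) 0.
    exists (cst 0); split.
    - by apply: continuous_subspaceT => s; exact: cst_continuous.
    - by move=> s _; rewrite /= normr0 ltW.
    - by apply: le_trans m1 _; exact: mulr_ge0 (ler0n _ _) (normr_ge0 _).
  have [n hn] : exists n, modulus dl y / 2 < modulus_upto dl n y.
    have hs : has_sup (range (fun n => modulus_upto dl n y)).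
      split; first by exists (modulus_upto dl 0 y), 0%N.
      by exists (2 * M) => _ [k _ <-]; have /andP[] := modulus_upto_bound dl k cy.
    have [_ [n _ <-] hn] := sup_adherent (divr_gt0 m1 (ltr0n _ 2)) hs.
    by exists n; move: hn; rewrite -/(modulus dl y); lra.
  elim: n hn => [|n IH] /=; first by lra.
  rewrite lt_max => /orP[//|]; case: asboolP => [sk h|_]; last by lra.
  by exists (dense_path n); split => //; [exact: cpath_dense_path|lra].
(* [z j] is an almost maximiser of the oscillation at scale [1 / (j + 1)]. *)
pose z j := xget (cst 0) [set z | [/\ cpath z, small j.+1%:R^-1 z &
    modulus j.+1%:R^-1 y <= 2 * gap y z]].
have hz j : [/\ cpath (z j), small j.+1%:R^-1 (z j) &
    modulus j.+1%:R^-1 y <= 2 * gap y (z j)].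
  exact: (xgetPex (cst 0) (ex_z j)).
have z0 : cvg_loc z (cst 0).
  move=> N e e0.
  have ev (c : R) : \forall m \near \oo, c < m.+1%:R.
    near=> m; apply: (@lt_trans _ _ m%:R); last by rewrite ltr_nat.
    by near: m; exact: nbhs_infty_gtr.
  near=> j => s /andP[s0 sN] /=; rewrite subr0.
  have [_ sz _] := hz j; apply: le_trans (sz s _) _.
    rewrite s0 invrK (le_trans sN)// ltW//; by near: j; exact: ev.
  rewrite -[leRHS]invrK lef_pV2 ?posrE ?invr_gt0//; apply: ltW.
  by near: j; exact: ev.
have fz : gap y (z j) @[j --> \oo] --> 0.
  rewrite (_ : 0 = `|f (fun s => y s + cst 0 s) - f y|); last first.
    rewrite (_ : (fun s => _) = y) ?subrr ?normr0//.
    by apply/funext => s; rewrite /= addr0.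
  apply: cvg_norm; apply: cvgB; last exact: cvg_cst.
  apply: fc; last exact: cvg_loc_addl.
    by move=> j; apply: cpathD => //; have [] := hz j.
  by rewrite (_ : (fun s => _) = y)//; apply/funext => s; rewrite /= addr0.
apply: (@squeeze_cvgr _ _ _ _ (fun=> 0) (fun j => 2 * gap y (z j))).
- near=> j; have /andP[-> _] := modulus_bound j.+1%:R^-1 cy.
  by have [] := hz j.
- exact: cvg_cst.
- by rewrite -[X in _ --> X](mulr0 2); apply: cvgMr; exact: fz.
Unshelve. all: by end_near. Qed.

Lemma modulus_upto_continuous dl n : path_continuous (modulus_upto dl n).
Proof.
move=> x_ x cx_ cx xx; elim: n => [|n IH] /=; first exact: cvg_cst.
apply: cvg_maxr => //; case: asboolP => _; last exact: cvg_cst.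
apply: cvg_norm; apply: cvgB; last exact: fc.
apply: fc; [| |by move=> N e e0; have := xx N e e0; apply: filterS => m h s /h;
  rewrite opprD addrACA subrr addr0].
- by move=> m; apply: cpathD => //; exact: cpath_dense_path.
- by apply: cpathD => //; exact: cpath_dense_path.
Qed.

Lemma modulus_upto_bounded dl n : path_bounded (modulus_upto dl n) (2 * M).
Proof.
by move=> y cy; have /andP[h1 h2] := modulus_upto_bound dl n cy; rewrite ger0_norm.
Qed.

Section one_process.
Context d {T : measurableType d} (P : probability T R) (X : R -> T -> R).
Hypothesis mX : forall t, 0 <= t -> measurable_fun setT (X t).
Hypothesis cX : continuous_paths X.

Lemma measurable_modulus dl : measurable_fun setT (fun w => modulus dl (X ^~ w)).
Proof.
apply: (measurable_fun_cvg (h := fun n w => modulus_upto dl n (X ^~ w))) => [n|w _].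
  apply: measurable_functional => //; exact: modulus_upto_continuous.
exact: modulus_upto_cvg.
Qed.

Lemma modulus_integral_cvg0 :
  (\int[P]_w (modulus j.+1%:R^-1 (X ^~ w))%:E)%E @[j --> \oo] --> 0%E.
Proof.
rewrite -[X in _ --> X](integral0 P setT).
apply: (bounded_cvg_integral (g := fun=> 0) (M := 2 * M)) => [j|w|j w].
- exact: measurable_modulus.
- exact: modulus_cvg0.
- by have /andP[h1 h2] := modulus_bound j.+1%:R^-1 (@cX w); rewrite ger0_norm.
Qed.

End one_process.

Lemma same_boxes_modulus d (T : measurableType d) (P : probability T R)
    (X : R -> T -> R) d' (T' : measurableType d') (Q : probability T' R)
    (Y : R -> T' -> R) dl :
  (forall t, 0 <= t -> measurable_fun setT (X t)) -> continuous_paths X ->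
  (forall t, 0 <= t -> measurable_fun setT (Y t)) -> continuous_paths Y ->
  same_boxes P X Q Y ->
  (\int[P]_w (modulus dl (X ^~ w))%:E = \int[Q]_w (modulus dl (Y ^~ w))%:E)%E.
Proof.
move=> mX cX mY cY XY.
have cvgX : (\int[P]_w (modulus_upto dl n (X ^~ w))%:E)%E @[n --> \oo] -->
    (\int[P]_w (modulus dl (X ^~ w))%:E)%E.
  apply: (bounded_cvg_integral (M := 2 * M)) => [n|w|n w].
  - apply: measurable_functional => //; exact: modulus_upto_continuous.
  - exact: modulus_upto_cvg.
  - exact: modulus_upto_bounded.
have cvgY : (\int[Q]_w (modulus_upto dl n (Y ^~ w))%:E)%E @[n --> \oo] -->
    (\int[Q]_w (modulus dl (Y ^~ w))%:E)%E.
  apply: (bounded_cvg_integral (M := 2 * M)) => [n|w|n w].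
  - apply: measurable_functional => //; exact: modulus_upto_continuous.
  - exact: modulus_upto_cvg.
  - exact: modulus_upto_bounded.
apply: (cvg_unique (@ereal_hausdorff R) cvgX).
rewrite (_ : (fun n => _) = (fun n => \int[Q]_w (modulus_upto dl n (Y ^~ w))%:E)%E)//.
apply/funext => n; apply: same_boxes_integral XY => //.
- exact: modulus_upto_continuous.
- exact: modulus_upto_bounded.
Qed.

End modulus.

(** * Brownian scaling and convergence in law *)

Section brownian_boxes.
Context {R : realType} d {T : measurableType d} (P : probability T R).

Definition skel_law (h : R) (i : nat) (C : set R) : \bar R :=
  if i is _.+1 then normal_prob 0%R (Num.sqrt h) C else dirac (0%R : R) C.

Fixpoint brownian_box (h : R) (A : nat -> set R) (n : nat) : \bar R :=
  if n is n'.+1 then (brownian_box h A n' * skel_law h n' (A n'))%E else 1%E.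

(** The first [n + 1] entries of the skeleton only involve the values up to the
time [n h]. *)
Lemma box_filtration (B : R -> T -> R) h n m A : 0 <= h ->
  (forall i, measurable (A i)) -> (m <= n.+1)%N ->
  natural_filtration B (n%:R * h) (box B h m A).
Proof.
move=> h0 mA; set J := (`[0, n%:R * h]%classic : set R).
have mB i : (i <= n)%N -> meas_wrt (process_sigma B J) (B (i%:R * h)).
  move=> ni; apply/meas_wrtP => C mC; rewrite process_sigma_id.
  apply: process_sigma_preimage => //.
  by rewrite /J /= in_itv/= (mulr_ge0 (ler0n _ _) h0)/= ler_wpM2r// ler_nat.
elim: m => [_|m IH mn].
  rewrite (_ : box _ _ _ _ = setT); first exact: process_sigmaT.
  by apply/seteqP; split.
rewrite boxS; apply: process_sigmaI; first exact: IH (ltnW mn).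
have ms : meas_wrt (process_sigma B J) (fun w => skel h (B ^~ w) m).
  case: m mn {IH} => [_|m mn] /=; first by have := mB 0%N (leq0n _); rewrite mul0r.
  by apply: measurable_realfun.measurable_funB; apply: mB => //; exact: ltnW.
by rewrite -process_sigma_id; exact: (meas_wrtP _ _).1.
Qed.

Lemma brownian_boxP (B : R -> T -> R) h n A : brownian_motion P B -> 0 < h ->
  (forall i, measurable (A i)) -> P (box B h n A) = brownian_box h A n.
Proof.
move=> bB h0 mA; elim: n => [|n IH].
  rewrite (_ : box _ _ _ _ = setT); first exact: probability_setT.
  by apply/seteqP; split.
rewrite boxS /=; case: n IH => [|n] IH.
  rewrite (_ : box _ _ _ _ = setT); last by apply/seteqP; split.
  rewrite setTI mul1e /skel_law diracE; have [A0|A0] := pselect (A 0%N 0).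
    rewrite mem_set// (_ : _ @^-1` _ = setT); first exact: probability_setT.
    by apply/seteqP; split => w //= _; rewrite (bm_start bB).
  rewrite memNset// (_ : _ @^-1` _ = set0); first exact: measure0.
  by rewrite -subset0 => w /=; rewrite (bm_start bB).
have nh : 0 <= n%:R * h < n.+1%:R * h.
  by rewrite (mulr_ge0 (ler0n _ _) (ltW h0))/= ltr_pM2r// ltr_nat.
have -> : (fun w => skel h (B ^~ w) n.+1) = increment B (n%:R * h) (n.+1%:R * h) by [].
rewrite (bm_indep bB nh)//; last exact: box_filtration (ltW h0) mA (leqnn _).
rewrite IH (bm_normal bB nh (mA _)).
rewrite (_ : n.+1%:R * h - n%:R * h = h) ?subrr//.
by rewrite -mulrBl -natr1 addrAC subrr add0r mul1r.
Qed.

Definition rescaled (t : R) (B : R -> T -> R) : R -> T -> R :=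
  fun s w => (Num.sqrt t)^-1 * B (s * t) w.

Lemma continuous_rescaled t (B : R -> T -> R) : 0 < t -> continuous_paths B ->
  continuous_paths (rescaled t B).
Proof. by move=> t0 cB w; apply: (@cpath_scale R _ t (B ^~ w)) => //; exact: cB. Qed.

Lemma measurable_rescaled t (B : R -> T -> R) : 0 < t ->
  (forall s, 0 <= s -> measurable_fun setT (B s)) ->
  forall s, 0 <= s -> measurable_fun setT (rescaled t B s).
Proof.
move=> t0 mB s s0; apply: measurable_realfun.measurable_funM => //.
by apply: mB; exact: mulr_ge0 s0 (ltW t0).
Qed.

(** The skeleton of the rescaled process is that of [B] on the mesh of step [h
t], divided by [sqrt t], and the standard deviations [sqrt (h t) / sqrt t] and
[sqrt h] agree. *)
Lemma rescaled_box (B : R -> T -> R) t h n A : brownian_motion P B -> 0 < t ->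
  0 < h -> (forall i, measurable (A i)) ->
  P (box (rescaled t B) h n A) = brownian_box h A n.
Proof.
move=> bB t0 h0 mA; have st0 : 0 < Num.sqrt t by rewrite sqrtr_gt0.
set c := (Num.sqrt t)^-1; have c0 : c != 0 by rewrite invr_eq0 gt_eqF.
pose A' i := (fun x : R => c * x) @^-1` A i.
have mA' i : measurable (A' i).
  rewrite -[A' i]setTI; apply: (measurable_realfun.measurable_funM) => //.
have -> : box (rescaled t B) h n A = box B (h * t) n A'.
  have sk w i : skel h (rescaled t B ^~ w) i = c * skel (h * t) (B ^~ w) i.
    by case: i => [|i] /=; rewrite /rescaled -/c ?mul0r// mulrBr !mulrA.
  by apply/seteqP; split => w hw i ni; have := hw i ni; rewrite /A' /= sk.
rewrite brownian_boxP//; last exact: mulr_gt0.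
have law i : skel_law (h * t) i (A' i) = skel_law h i (A i).
  case: i => [|i]; rewrite /skel_law.
    rewrite !diracE /A'; congr ((_ : bool)%:R%:E).
    by apply: asbool_equiv_eq; rewrite /= mulr0.
  have ht : Num.sqrt (h * t) != 0 by rewrite gt_eqF// sqrtr_gt0 mulr_gt0.
  have cht : c * Num.sqrt (h * t) = Num.sqrt h.
    by rewrite (sqrtrM _ (ltW h0)) mulrCA mulVf ?gt_eqF// mulr1.
  by rewrite -cht -(normal_prob_scale c0 ht (mA _)).
by elim: n => [//|n IH]; rewrite /= IH law.
Qed.

End brownian_boxes.

Lemma rescaled_same_boxes (R : realType) d (T : measurableType d)
    (P : probability T R) (B : R -> T -> R) d' (T' : measurableType d')
    (Q : probability T' R) (B' : R -> T' -> R) t : 0 < t ->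
  brownian_motion P B -> brownian_motion Q B' -> same_boxes P (rescaled t B) Q B'.
Proof. by move=> t0 bB bB' h n A h0 mA; rewrite rescaled_box// brownian_boxP. Qed.

Section comparison.
Context {R : realType} d {T : measurableType d} (P : probability T R).
Variables (f : (R -> R) -> R) (M : R).
Hypotheses (fc : path_continuous f) (fM : path_bounded f M).
Variables (X Y : R -> T -> R).
Hypothesis mX : forall t, 0 <= t -> measurable_fun setT (X t).
Hypothesis cX : continuous_paths X.
Hypothesis mY : forall t, 0 <= t -> measurable_fun setT (Y t).
Hypothesis cY : continuous_paths Y.

(** Where the two paths are close, the values of [f] differ by at most the
oscillation of [f] at [Y]; elsewhere they differ by at most [2 M]. *)
Lemma functional_distance dl kappa : 0 < dl ->
  (mu_ext P [set w | ~ small (dl / 2) (fun s => X s w - Y s w)%R] <= kappa%:E)%E ->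
  (`|\int[P]_w (f (X ^~ w))%:E - \int[P]_w (f (Y ^~ w))%:E| <=
   \int[P]_w (modulus f dl (Y ^~ w))%:E + (2 * M * kappa)%:E)%E.
Proof.
move=> dl0 hk; have M0 := M_ge0 fM.
pose D w := `|f (X ^~ w) - f (Y ^~ w)|.
have mfX := measurable_functional fc mX cX.
have mfY := measurable_functional fc mY cY.
have mD : measurable_fun setT D.
  apply: (measurableT_comp (f := fun x : R => `|x|)) => //.
  exact: measurable_realfun.measurable_funB.
have mG := measurable_modulus fc fM mY cY dl.
pose bad := [set w | modulus f dl (Y ^~ w) < D w].
have mbad : measurable bad.
  rewrite (_ : bad = (fun w => D w - modulus f dl (Y ^~ w)) @^-1` `]0, +oo[).
    rewrite -[X in measurable X]setTI.
    by apply: (measurable_realfun.measurable_funB mD mG).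
  by apply/seteqP; split => w /=; rewrite in_itv/= andbT subr_gt0.
have Pbad : (P bad <= kappa%:E)%E.
  rewrite -(measurable_mu_extE P mbad); apply: le_trans hk; apply: le_mu_ext => w /= h sm.
  by move: h; rewrite /bad /= ltNge (modulusP fc fM dl0 (@cX w) (@cY w) sm).
have Dle w : D w <= modulus f dl (Y ^~ w) + 2 * M * \1_bad w.
  rewrite indicE; have [h|h] := pselect (bad w).
    rewrite mem_set// mulr1; have /andP[h0 _] := modulus_bound fM dl (@cY w).
    apply: le_trans (ler_normB _ _) _.
    by have := fM (@cX w); have := fM (@cY w); lra.
  by rewrite memNset// mulr0 addr0 leNgt; exact/negP.
have iX : P.-integrable setT (fun w => (f (X ^~ w))%:E).
  exact: (@integrable_functional _ _ _ fc fM).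
have iY : P.-integrable setT (fun w => (f (Y ^~ w))%:E).
  exact: (@integrable_functional _ _ _ fc fM).
rewrite -integralB//.
have mXY : measurable_fun setT (fun w => ((f (X ^~ w))%:E - (f (Y ^~ w))%:E)%E).
  apply/measurable_EFinP; exact: measurable_realfun.measurable_funB.
apply: le_trans (le_abse_integral P measurableT mXY) _.
apply: (@le_trans _ _ (\int[P]_w ((modulus f dl (Y ^~ w))%:E + (2 * M * \1_bad w)%:E))%E).
  apply: ge0_le_integral => //.
  - exact: measurableT_comp.
  - apply/measurable_EFinP; apply: measurable_realfun.measurable_funD => //.
    by apply: measurable_realfun.measurable_funM => //; exact: measurable_indic.
  - by move=> w _; rewrite -EFinB -EFinD /= lee_fin; exact: Dle.
rewrite ge0_integralD//; last 4 first.
- by move=> w _; rewrite lee_fin; have /andP[] := modulus_bound fM dl (@cY w).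
- exact/measurable_EFinP.
- by move=> w _; rewrite lee_fin indicE mulr_ge0// mulr_ge0.
- apply/measurable_EFinP.
  by apply: measurable_realfun.measurable_funM => //; exact: measurable_indic.
rewrite leeD2l//.
under eq_integral do rewrite EFinM.
rewrite integralZl//; last exact: integrable_indic.
rewrite integral_indic// setIT (EFinM (2 * M) kappa) lee_wpmul2l// lee_fin; exact: mulr_ge0.
Qed.

End comparison.

Unset Implicit Arguments.

Theorem theorem3p1 (R : realType)
    (d : measure_display) (T : measurableType d) (P : probability T R)
    (lambda : R) (W Z : R -> T -> R[i]) (theta : R -> T -> R)
    (d' : measure_display) (T' : measurableType d') (Q : probability T' R)
    (gamma : R -> T' -> R) :
  0 <= lambda ->
  planar_brownian_motion P W ->
  ou_process P lambda (1 +i* 0) W Z ->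
  winding_process P (natural_filtration (fun t w => cpair (W t w))) Z theta ->
  brownian_motion Q gamma ->
  cvg_in_law_skorokhod P Q
    (fun t s w => (Num.sqrt t)^-1 * theta (s * t) w) (0^'+) gamma.
Proof.
move=> lambda0 pW ouZ wtheta bg f /skorokhod_path_continuous fc.
move=> /skorokhod_path_bounded[M fM].
have [_ bV _] := pW; set V := Im_process W in bV.
have mth := winding_measurable wtheta; have cth := winding_continuous wtheta.
have mV := bm_measurable bV; have cV := bm_continuous bV.
have mg := bm_measurable bg; have cg := bm_continuous bg.
have M0 := M_ge0 fM.
rewrite unlock.
have fin_int d0 (T0 : measurableType d0) (P0 : probability T0 R) (X : R -> T0 -> R) :
    (forall t, 0 <= t -> measurable_fun setT (X t)) -> continuous_paths X ->
    (\int[P0]_w (f (X ^~ w))%:E)%E \is a fin_num.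
  by move=> mX cX; apply: integrable_fin_num => //; exact: (@integrable_functional _ _ _ fc fM).
rewrite -[X in _ --> X]fineK; last exact: fin_int.
apply/fine_cvgP; split.
  near=> t; have t0 : 0 < t by near: t; exact: nbhs_right_gt.
  exact: fin_int (measurable_rescaled t0 mth) (continuous_rescaled t0 cth).
apply/cvgrPdist_le => e e0.
have e2 : 0 < e / 2 by rewrite divr_gt0.
have mod0 : (\int[Q]_w (modulus f j.+1%:R^-1 (gamma ^~ w))%:E)%E @[j --> \oo] --> 0%E.
  exact: (@modulus_integral_cvg0 _ _ _ fc fM).
have [j _ /(_ j (leqnn j)) hj] := cvg0_eventually_le mod0 e2.
set dl : R := j.+1%:R^-1 in hj.
have dl0 : 0 < dl by rewrite invr_gt0.
(* On the horizon [t / a] and at the level [a * sqrt a * sqrt (t / a)], closeness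
   means, once rescaled, closeness up to [a] on [[0, 1 / a]]. *)
pose a := dl / 2; have a0 : 0 < a by rewrite divr_gt0.
pose kappa := e / (4 * (M + 1)).
have M1 : 0 < 4 * (M + 1) by rewrite mulr_gt0// ltr_wpDl.
have kappa0 : 0 < kappa by rewrite divr_gt0.
have ak : 0 < a * Num.sqrt a by rewrite mulr_gt0// sqrtr_gt0.
have [tau0 tau00 close] := winding_close lambda0 pW ouZ wtheta ak kappa0.
near=> t.
have t0 : 0 < t by near: t; exact: nbhs_right_gt.
have ttau : t < a * tau0 by near: t; apply: nbhs_right_lt; rewrite mulr_gt0.
have bd : (mu_ext P [set w | ~ small (dl / 2)
    (fun s => rescaled t theta s w - rescaled t V s w)%R] <= kappa%:E)%E.
  have tta : 0 < t / a <= tau0 by rewrite divr_gt0//= ler_pdivrMr// mulrC ltW.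
  apply: le_trans (close _ tta); apply: le_mu_ext => w /= ns.
  apply: contrapT => nap; apply: ns => s /andP[s0]; rewrite -/a => sa.
  have st0 : 0 < Num.sqrt t by rewrite sqrtr_gt0.
  rewrite /rescaled -mulrBr normrM gtr0_norm ?invr_gt0// ler_pdivrMl//.
  have aE : a * Num.sqrt a * Num.sqrt (t / a) = Num.sqrt t * a.
    rewrite -mulrA -sqrtrM ?(ltW a0)// mulrCA divff ?gt_eqF// mulr1 mulrC.
    by [].
  rewrite leNgt; apply/negP => h; apply: nap; exists (s * t).
    by rewrite (mulr_ge0 s0 (ltW t0))/= mulrC ler_pM2l.
  by rewrite aE.
have dist := functional_distance fc fM (measurable_rescaled t0 mth)
  (continuous_rescaled t0 cth) (measurable_rescaled t0 mV) (continuous_rescaled t0 cV)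
  dl0 bd.
have sb := rescaled_same_boxes t0 bV bg.
have Eg := same_boxes_integral fc fM (measurable_rescaled t0 mV)
  (continuous_rescaled t0 cV) mg cg sb.
have Em := same_boxes_modulus fc fM dl (measurable_rescaled t0 mV)
  (continuous_rescaled t0 cV) mg cg sb.
rewrite Eg Em in dist.
rewrite distrC -lee_fin; apply: (@le_trans _ _ ((e / 2)%:E + (2 * M * kappa)%:E)%E).
  apply: le_trans (leeD hj (lexx _)); apply: le_trans dist.
  rewrite -abse_EFin EFinB !fineK//; first exact: fin_int.
  exact: fin_int (measurable_rescaled t0 mth) (continuous_rescaled t0 cth).
rewrite -EFinD lee_fin.
have : 2 * M * kappa <= e / 2.
  rewrite /kappa mulrA ler_pdivrMr//; nra.
lra.
Unshelve. all: by end_near. Qed.
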